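(* Let $\nu$ be a Thorin measure on $\mathbb{R}_+^d$ satisfying $\int_{\mathbb{R}_+^d}\|s\|\,\nu(\mathrm{d}s)<\infty$, let $X\sim\mathcal{G}_d(\nu)$, and let $\mathcal{F}_\nu$ be a class of test functions $f:\mathbb{R}^d\to\mathbb{R}^d$ for which the Stein identity $$\mathbb{E}\bigl[\langle X,f(X)\rangle\bigr]=\int_{\mathbb{R}_+^d}\int_0^\infty e^{-z}\,\mathbb{E}\bigl[\langle s,f(X+zs)\rangle\bigr]\,\mathrm{d}z\,\nu(\mathrm{d}s)$$ is well-defined. Then the Stein operator for $X$ on $\mathcal{F}_\nu$ given by $$(\mathcal{T}_\nu f)(x)=\langle x,f(x)\rangle-\int_{\mathbb{R}_+^d}\int_0^\infty e^{-z}\,\langle s,f(x+zs)\rangle\,\mathrm{d}z\,\nu(\mathrm{d}s),\qquad x\in\mathbb{R}^d,$$ can be rewritten as $$(\mathcal{T}_\nu f)(x)=\langle x,f(x)\rangle-\int_{\mathbb{R}_+^d\setminus\{0\}}\langle y,f(x+y)\rangle\,\Pi(\mathrm{d}y),\qquad x\in\mathbb{R}^d,$$ where $\Pi$ is the Lévy measure of $X$, defined as the pushforward of $\nu\otimes\frac{e^{-z}}{z}\,\mathrm{d}z$ under the map $(s,z)\mapsto zs$, that is, $$\int_{\mathbb{R}_+^d\setminus\{0\}}g(y)\,\Pi(\mathrm{d}y)=\int_{\mathbb{R}_+^d}\int_0^\infty g(zs)\,\frac{e^{-z}}{z}\,\mathrm{d}z\,\nu(\mathrm{d}s)$$ for every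 Borel-measurable $g:\mathbb{R}_+^d\setminus\{0\}\to\mathbb{R}_+$.
   Context: $d\ge 1$ is a fixed integer, $\mathbb{R}_+=[0,\infty)$, and $\langle\cdot,\cdot\rangle$, $\|\cdot\|$ are the Euclidean scalar product and norm. A Thorin measure on $\mathbb{R}_+^d$ is a positive Radon measure $\nu$ on $\mathbb{R}_+^d$ with $\int_{\{\|s\|\le 1\}}\bigl|\log\|s\|\bigr|\,\nu(\mathrm{d}s)<\infty$ and $\int_{\{\|s\|>1\}}\|s\|^{-1}\,\nu(\mathrm{d}s)<\infty$. A random vector $X$ with values in $\mathbb{R}_+^d$ is a multivariate generalized gamma convolution with Thorin measure $\nu$, written $X\sim\mathcal{G}_d(\nu)$, if its characteristic function $\varphi_X$ satisfies $\log\varphi_X(t)=-\int_{\mathbb{R}_+^d}\log(1-\mathrm{i}\langle s,t\rangle)\,\nu(\mathrm{d}s)$ for all $t\in\mathbb{R}^d$. A linear operator $\mathcal{T}$ on a class $\mathcal{F}$ of test functions is a Stein operator for $X$ on $\mathcal{F}$ if $\mathbb{E}[(\mathcal{T}f)(X)]=0$ for every $f\in\mathcal{F}$. That $\Pi$ is the Lévy measure of $X$ means $\log\varphi_X(t)=\int_{\mathbb{R}_+^d\setminus\{0\}}(e^{\mathrm{i}\langle t,y\rangle}-1)\,\Pi(\mathrm{d}y)$ for all $t\in\mathbb{R}^d$. *)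

(* Defs.v *)
From HB Require Import structures.
From mathcomp Require Import all_boot all_order all_algebra.
From mathcomp Require Import all_classical all_reals all_analysis measurable_realfun.
From mathcomp Require Import complex.

Set Implicit Arguments.
Unset Strict Implicit.
Unset Printing Implicit Defensive.

Import Order.TTheory GRing.Theory Num.Theory.
Import numFieldNormedType.Exports.

Local Open Scope classical_set_scope.
Local Open Scope ring_scope.
Local Open Scope complex_scope.

(* Vectors of R^d are row vectors 'rV[R]_d, with the Borel sigma-algebra of
   the library topology; that topology comes from the sup norm, hence is the
   Euclidean one. *)
Section borel_matrix.
Context {R : realType} (m n : nat).

Let borel : set (set 'M[R]_(m, n)) := <<s @open 'M[R]_(m, n) >>.

Let borel0 : borel set0.
Proof. exact: sigma_algebra0. Qed.

Let borelC A : borel A -> borel (~` A).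
Proof. exact: sigma_algebraC. Qed.

Let borel_bigcup (F : (set 'M[R]_(m, n))^nat) :
  (forall i, borel (F i)) -> borel (\bigcup_i F i).
Proof. exact: sigma_algebra_bigcup. Qed.

HB.instance Definition _ :=
  @isMeasurable.Build (sigma_display (@open 'M[R]_(m, n))) 'M[R]_(m, n)
    borel borel0 borelC borel_bigcup.

End borel_matrix.

Section vectors.
Context {R : realType} {d : nat}.
Implicit Types u v : 'rV[R]_d.

Definition dot u v : R := \sum_(i < d) u ord0 i * v ord0 i.

Definition enorm u : R := Num.sqrt (dot u u).

Definition orthant : set 'rV[R]_d := [set u | forall i, 0 <= u ord0 i].

Definition orthant_neq0 : set 'rV[R]_d := orthant `\ 0.

End vectors.

(* A function into R^d is Borel measurable as soon as its coordinates are. *)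
Lemma measurable_coord_rV {R : realType} {d : nat} {disp : measure_display}
    {T : measurableType disp} (f : T -> 'rV[R]_d) :
  (forall i, measurable_fun setT (fun t => f t ord0 i)) ->
  measurable_fun setT f.
Proof.
move=> mf; apply: (@measurability _ _ _ _ _ _ (@open 'rV[R]_d)) => //.
move=> _ [A oA <-]; rewrite setTI.
pose q2v (q : 'rV[rat]_d) : 'rV[R]_d := map_mx ratr q.
pose B (qn : 'rV[rat]_d * nat) : set 'rV[R]_d :=
  ball (q2v qn.1) (qn.2.+1%:R^-1).
pose G (qn : 'rV[rat]_d * nat) : set 'rV[R]_d :=
  if `[< B qn `<=` A >] then B qn else set0.
have -> : A = \bigcup_qn G qn.
  apply/seteqP; split => [x Ax|x [qn _]]; last first.
    by rewrite /G; case: asboolP => // BA /BA.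
  have /nbhs_ballP[e /= e0 eA] : nbhs x A by exact: open_nbhs_nbhs.
  have [n _ ne] := near_infty_natSinv_lt (PosNum (divr_gt0 e0 (ltr0n R 2))).
  have {}ne : n.+1%:R^-1 < e / 2 := ne n (leqnn n).
  have n0 : 0 < n.+1%:R^-1 :> R by rewrite invr_gt0.
  have /choice[q qx] : forall i : 'I_d, exists r : rat,
      `|x ord0 i - ratr r| < n.+1%:R^-1.
    move=> i.
    have [|r] := @rat_in_itvoo R (x ord0 i - n.+1%:R^-1)
                                 (x ord0 i + n.+1%:R^-1).
      by rewrite ltrD2l gtrN.
    rewrite in_itv/= => r01; exists r.
    by rewrite ltr_distlC.
  exists (\row_i q i, n) => //; rewrite /G asboolT.
    split => // i j; rewrite ord1 /ball/= distrC !mxE distrC.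
    by rewrite distrC.
  move=> y [_ yq]; apply: eA; split => // i j.
  move: (yq i j); rewrite ord1 /ball/= !mxE => {}yq.
  rewrite (splitr e) (le_lt_trans (ler_distD (ratr (q j)) _ _))// ltrD//.
    exact: lt_trans (qx j) ne.
  exact: lt_trans yq ne.
rewrite preimage_bigcup; apply: countable_bigcupT_measurable => // qn.
rewrite /G; case: asboolP => // _; last by rewrite preimage_set0.
rewrite [X in measurable X](_ : _ = \bigcap_(j in [set: 'I_d])
    (setT `&` (fun t => f t ord0 j) @^-1` ball (q2v qn.1 ord0 j) qn.2.+1%:R^-1)).
  apply: fin_bigcap_measurable => // j _; apply: mf => //.
  apply: open_measurable; exact: (@ball_open R R^o).
apply/seteqP; split => [t h j _|t /= h].
  by split => //; move: h => [_]; exact.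
split; first by rewrite invr_gt0.
by move=> i j; rewrite ord1; have [] := h j I.
Qed.

Section complex_functions.
Context {R : realType}.

Definition cexp (z : R[i]) : R[i] :=
  (expR (complex.Re z) * cos (complex.Im z)) +i* (expR (complex.Re z) * sin (complex.Im z)).

Definition cmod (z : R[i]) : R := Num.sqrt (complex.Re z ^+ 2 + complex.Im z ^+ 2).

(* carg is the principal argument, in ]-pi, pi]; carg and clog are junk
   values at 0. *)
Definition carg (z : R[i]) : R :=
  if 0 <= complex.Im z then acos (complex.Re z / cmod z) else - acos (complex.Re z / cmod z).

Definition clog (z : R[i]) : R[i] := ln (cmod z) +i* carg z.

Definition cintegrable {disp} {T : measurableType disp}
    (mu : {measure set T -> \bar R}) (D : set T) (f : T -> R[i]) :=
  mu.-integrable D (fun x => (complex.Re (f x))%:E) /\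
  mu.-integrable D (fun x => (complex.Im (f x))%:E).

Definition cintegral {disp} {T : measurableType disp}
    (mu : {measure set T -> \bar R}) (D : set T) (f : T -> R[i]) : R[i] :=
  (\int[mu]_(x in D) complex.Re (f x)) +i* (\int[mu]_(x in D) complex.Im (f x)).

End complex_functions.

Section gamma_levy.
Context {R : realType}.

Definition gamma_levy_density : R -> R :=
  (fun z => expR (- z) / z) \_ `]0, +oo[.

Definition gamma_levy (A : set R) : \bar R :=
  (\int[lebesgue_measure]_(z in A) (gamma_levy_density z)%:E)%E.

Lemma gamma_levy_density_ge0 z : 0 <= gamma_levy_density z.
Proof.
rewrite /gamma_levy_density patchE; case: ifPn => //.
rewrite inE/= in_itv/= andbT => z0.
by rewrite divr_ge0 ?expR_ge0// ltW.
Qed.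

Lemma measurable_gamma_levy_density : measurable_fun setT gamma_levy_density.
Proof.
apply/(measurable_restrict _ _ _) => //; rewrite setTI.
apply: open_continuous_measurable_fun; first exact: interval_open.
move=> z; rewrite inE/= in_itv/= andbT => z0.
apply: cvgM.
  by apply: continuous_comp; [exact: opp_continuous|exact: continuous_expR].
by apply: cvgV; [rewrite gt_eqF|exact: cvg_id].
Qed.

Let gamma_levy0 : gamma_levy set0 = 0%E.
Proof. by rewrite /gamma_levy integral_set0. Qed.

Let gamma_levy_ge0 A : (0 <= gamma_levy A)%E.
Proof.
by apply: integral_ge0 => z _; rewrite lee_fin gamma_levy_density_ge0.
Qed.

Let gamma_levy_sigma_additive : semi_sigma_additive gamma_levy.
Proof.
apply: (@semi_sigma_additive_nng_induced _ _ R lebesgue_measure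
  (EFin \o gamma_levy_density)).
  by apply/measurable_EFinP; exact: measurable_gamma_levy_density.
by move=> z; rewrite lee_fin gamma_levy_density_ge0.
Qed.

HB.instance Definition _ := isMeasure.Build _ _ _ gamma_levy
  gamma_levy0 gamma_levy_ge0 gamma_levy_sigma_additive.

Let gamma_levy_sigma_finite : sigma_finite setT gamma_levy.
Proof.
pose F n : set R := `]-oo, 0]%classic `|` `[n.+1%:R^-1, n.+1%:R]%classic.
exists F.
  apply/seteqP; split => // z _.
  have [z0|z0] := leP z 0.
    by exists 0%N => //; left; rewrite /= in_itv.
  have [n1 _ n1z] := near_infty_natSinv_lt (PosNum z0).
  pose n := maxn n1 (Num.truncn z).
  exists n => //; right; rewrite /= in_itv/=; apply/andP; split.
    by apply: ltW; apply: (n1z n); rewrite /= leq_maxl.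
  rewrite (le_trans (ltW (truncnS_gt z)))// ler_nat ltnS leq_maxr//.
move=> n; have mF : measurable (F n) by apply: measurableU; exact: measurable_itv.
split=> //; rewrite /gamma_levy.
apply: (@le_lt_trans _ _ (\int[lebesgue_measure]_(z in F n)
    (n.+1%:R * \1_(`[0, n.+1%:R]%classic : set R) z)%:E)%E).
  apply: ge0_le_integral => //.
  - by move=> z _; rewrite lee_fin gamma_levy_density_ge0.
  - apply/measurable_funTS/measurable_EFinP.
    exact: measurable_gamma_levy_density.
  - by apply/measurable_funTS/measurable_EFinP/measurable_funM.
  move=> z Fz; rewrite lee_fin /gamma_levy_density patchE; case: ifPn; last first.
    by rewrite mulr_ge0.
  rewrite inE/= in_itv/= andbT => z0; case: Fz => /=; rewrite in_itv/=.
    by rewrite leNgt z0.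
  move=> /andP[nz zn]; rewrite indicE mem_set/=; last first.
    by rewrite in_itv/= zn ltW.
  rewrite mulr1 -[leRHS]mul1r; apply: ler_pM.
  - exact: expR_ge0.
  - by rewrite invr_ge0 ltW.
  - by rewrite -[leRHS]expR0 ler_expR oppr_le0 ltW.
  - by rewrite invf_ple ?posrE.
apply: (@le_lt_trans _ _ (\int[lebesgue_measure]_z
    (n.+1%:R * \1_(`[0, n.+1%:R]%classic : set R) z)%:E)%E).
  apply: ge0_subset_integral => //.
  by apply/measurable_EFinP/measurable_funM.
under eq_integral do rewrite EFinM.
rewrite ge0_integralZl//; last by apply/measurable_EFinP.
rewrite integral_indic// setIT.
apply: lte_mul_pinfty => //; rewrite /= lebesgue_measure_itv/=.
by case: ifP => // _; rewrite -EFinB ltry.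
Qed.

HB.instance Definition _ := Measure_isSigmaFinite.Build _ _ _ gamma_levy
  gamma_levy_sigma_finite.

End gamma_levy.

Section levy_measure.
Context {R : realType} {d : nat}.
Variable nu : {measure set 'rV[R]_d -> \bar R}.

Definition ray (p : 'rV[R]_d * R) : 'rV[R]_d := p.2 *: p.1.

Lemma measurable_coord (i : 'I_d) :
  measurable_fun setT (fun u : 'rV[R]_d => u ord0 i).
Proof.
apply: (measurability _ (RGenOpens.measurableE R)).
move=> _ [_ [a [b ->] <-]]; rewrite setTI; apply: sub_sigma_algebra.
have /continuousP := @coord_continuous R 1 d ord0 i.
by apply; exact: interval_open.
Qed.

Lemma measurable_ray : measurable_fun setT ray.
Proof.
apply: measurable_coord_rV => i; rewrite /ray.
under eq_fun do rewrite mxE.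
apply: measurable_funM => //.
by apply: (measurableT_comp (measurable_coord i)).
Qed.

(* image of nu (x) e^{-z}/z dz under (s, z) |-> z s *)
Definition levy_measure : set 'rV[R]_d -> \bar R :=
  pushforward (nu \x @gamma_levy R)%E ray.

Let levy_measure0 : levy_measure set0 = 0%E.
Proof. by rewrite /levy_measure /pushforward preimage_set0 measure0. Qed.

Let levy_measure_ge0 A : (0 <= levy_measure A)%E.
Proof. by rewrite /levy_measure /pushforward measure_ge0. Qed.

Let levy_measure_sigma_additive : semi_sigma_additive levy_measure.
Proof.
have mray A : measurable A -> measurable (ray @^-1` A).
  by move=> mA; rewrite -[X in measurable X]setTI; exact: measurable_ray.
move=> F mF tF mUF; rewrite /levy_measure /pushforward preimage_bigcup.
apply: measure_semi_sigma_additive.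
- by move=> n; exact: mray.
- apply/trivIsetP => i j _ _ ij; rewrite -preimage_setI.
  by move/trivIsetP : tF => /(_ _ _ _ _ ij) ->//; rewrite preimage_set0.
- by rewrite -preimage_bigcup; exact: mray.
Qed.

HB.instance Definition _ := isMeasure.Build _ _ _ levy_measure
  levy_measure0 levy_measure_ge0 levy_measure_sigma_additive.

End levy_measure.

(* A measure on R_+^d is a Borel measure on R^d that does not charge the
   complement of R_+^d.  On R^d, Radon means finite on compact sets.  lne is
   the extended logarithm: lne 0 = -oo, so the third condition excludes an
   atom at 0 (whereas ln 0 = 0). *)
Definition thorin_measure {R : realType} {d : nat}
    (nu : {measure set 'rV[R]_d -> \bar R}) : Prop :=
  [/\ nu (~` orthant) = 0%E,
      forall K : set 'rV[R]_d, compact K -> (nu K < +oo)%E,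
      (\int[nu]_(s in orthant `&` [set s | (enorm s <= 1)%R])
         `|lne (enorm s)%:E| < +oo)%E &
      (\int[nu]_(s in orthant `&` [set s | (1 < enorm s)%R])
         (enorm s)^-1%:E < +oo)%E].

Section laws.
Context {R : realType} {d : nat} {disp : measure_display}
        {Omega : measurableType disp}.
Variables (P : probability Omega R) (X : {RV P >-> 'rV[R]_d}).
Implicit Types (nu Pi : {measure set 'rV[R]_d -> \bar R}).

Definition chf (t : 'rV[R]_d) : R[i] :=
  cintegral P setT (fun w => cexp (0 +i* dot t (X w))).

(* psi is log chf, the distinguished logarithm: the only continuous psi with
   psi 0 = 0 and exp psi = chf.  (The principal logarithm of chf t would be
   wrong in general, since its imaginary part is confined to ]-pi, pi].) *)
Definition is_log_chf (psi : 'rV[R]_d -> R[i]) : Prop :=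
  [/\ continuous (fun t => complex.Re (psi t)),
      continuous (fun t => complex.Im (psi t)),
      psi 0 = 0 &
      forall t, chf t = cexp (psi t)].

(* X ~ G_d(nu); the Thorin conditions make the integral absolutely
   convergent *)
Definition is_ggc nu : Prop :=
  [/\ thorin_measure nu,
      forall w, orthant (X w) &
      is_log_chf
        (fun t => - cintegral nu orthant (fun s => clog (1 -i* dot s t)))].

Definition is_levy_measure Pi : Prop :=
  let h t y := cexp (0 +i* dot t y) - 1 in
  [/\ Pi (~` orthant_neq0) = 0%E,
      forall t, cintegrable Pi orthant_neq0 (h t) &
      is_log_chf (fun t => cintegral Pi orthant_neq0 (h t))].

(* T is an operator on F, (T f) x being defined for x in dom f: T is linear
   and E[(T f)(X)] = 0 on F; the last condition includes that (T f)(X) is almost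
   surely defined and integrable. *)
Definition is_stein_operator (F : set ('rV[R]_d -> 'rV[R]_d))
    (dom : ('rV[R]_d -> 'rV[R]_d) -> set 'rV[R]_d)
    (T : ('rV[R]_d -> 'rV[R]_d) -> 'rV[R]_d -> R) : Prop :=
  (forall (a : R) f g, let h := fun x => a *: f x + g x in
     F f -> F g -> F h ->
     forall x, dom f x -> dom g x ->
     dom h x /\ T h x = a * T f x + T g x) /\
  (forall f, F f ->
     [/\ {ae P, forall w, dom f (X w)},
         P.-integrable setT (fun w => (T f (X w))%:E) &
         ('E_P[fun w => T f (X w)] = 0)%E]).

(* both sides of
     E<X, f X> = \int \int_0^oo e^{-z} E<s, f (X + z s)> dz nu(ds)
   converge absolutely *)
Definition stein_identity_defined nu (f : 'rV[R]_d -> 'rV[R]_d) : Prop :=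
  [/\ measurable_fun setT f,
      P.-integrable setT (fun w => (dot (X w) (f (X w)))%:E) &
      (\int[nu]_(s in orthant) \int[lebesgue_measure]_(z in `]0%R, +oo[)
         ((expR (- z))%:E *
          \int[P]_w (`|dot s (f (X w + z *: s))|%R)%:E) < +oo)%E].

End laws.

Arguments chf {R d disp Omega} P X.
Arguments is_log_chf {R d disp Omega} P X.
Arguments is_ggc {R d disp Omega} P X.
Arguments is_levy_measure {R d disp Omega} P X.
Arguments is_stein_operator {R d disp Omega} P X.
Arguments stein_identity_defined {R d disp Omega} P X.

Section stein_operator.
Context {R : realType} {d : nat}.
Implicit Types (nu Pi : {measure set 'rV[R]_d -> \bar R})
               (f : 'rV[R]_d -> 'rV[R]_d).

Definition stein_op nu f (x : 'rV[R]_d) : R :=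
  dot x (f x) -
  \int[nu]_(s in orthant) \int[lebesgue_measure]_(z in `]0, +oo[)
    (expR (- z) * dot s (f (x + z *: s))).

(* the points where the double integral in stein_op converges absolutely;
   elsewhere (stein_op nu f x) is a junk value *)
Definition stein_op_dom nu f : set 'rV[R]_d :=
  [set x | (\int[nu]_(s in orthant) \int[lebesgue_measure]_(z in `]0%R, +oo[)
              (expR (- z) * `|dot s (f (x + z *: s))|)%:E < +oo)%E].

Definition stein_op_levy Pi f (x : 'rV[R]_d) : R :=
  dot x (f x) - \int[Pi]_(y in orthant_neq0) dot y (f (x + y)).

End stein_operator.

(* Main.v *)
Require Import Defs.
From HB Require Import structures.
From mathcomp Require Import all_boot all_order all_algebra.
From mathcomp Require Import all_classical all_reals all_analysis measurable_realfun.
From mathcomp Require Import complex.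
From mathcomp Require Import ring lra.

Set Implicit Arguments.
Unset Strict Implicit.
Unset Printing Implicit Defensive.

Import Order.TTheory GRing.Theory Num.Theory.
Import numFieldNormedType.Exports.

Local Open Scope classical_set_scope.
Local Open Scope ring_scope.

(** The Levy measure Pi is the image of nu (x) e^(-z)/z dz under (s, z) |-> z s,
    so for z > 0 the factor z of <z s, f(x + z s)> cancels the pole of the
    density: both forms of the operator are one double integral, and the
    formula for g, the domains and the operators agree by Tonelli and Fubini
    ([ge0_integral_levy_orthant], [stein_op_domP], [stein_op_levyE]).  Product
    measures require nu to be sigma-finite: the logarithmic Thorin condition
    forbids an atom at 0 and the norm is nu-integrable, so the sets where the
    norm exceeds 1/(n+1) exhaust the mass of nu.

    Pi is the Levy measure of X because of the Frullani integrals of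
    (cos(zu) - 1) e^(-z)/z and sin(zu) e^(-z)/z over the half-line, which are
    - ln sqrt(1 + u^2) and atan u, that is the two parts of - log(1 - i u)
    ([gamma_cos], [gamma_sin]).  They are found by differentiating in u.

    The remaining content is E[(T f)(X)] = 0, the Stein identity
      E<X, f(X)> = int E<y, f(X + y)> Pi(dy),
    proved in [stein_identity] from the characteristic function phi alone.
    - X has a mean: |Im phi(h e_j)| <= C |h|, and Im phi(h e_j) is the derivative
      in h of E[(1 - cos(h X_j)) / X_j], which is therefore at most C h^2; Fatou's
      lemma applied as h tends to 0 gives E X_j <= 2 C.
    - One may then differentiate phi = exp(log phi) under both integral signs.
      In direction e_j this reads
        E[X_j e^(i<t,X>)] = phi(t) int y_j e^(i<t,y>) Pi(dy),
      which is the j-th coordinate of the Stein identity for the test function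
      e^(i<t,.>).
    - Both sides of that coordinate are continuous for bounded pointwise
      limits, and the bounded Borel functions are the smallest class closed
      under linear combinations and such limits that contains the functions
      cos<t,.> and sin<t,.> ([trig_hull]); so the identity holds for every
      bounded Borel function.
    - A test function f is reached by its truncations to |f| <= n.  Summing over
      the coordinates before n tends to infinity matters: only the sums <X, f(X)>
      and <y, f(X + y)> are integrable, their terms need not be. *)

(** * The closure of a class of functions under bounded limits *)

Section hull.
Context {R : realType} {T : Type}.
Implicit Types (E : set (T -> R)) (f g : T -> R).

(** The class is defined by closure, with a bound required along each limit, so
    that every property stable under linear combinations and dominated
    convergence is proved on all of it by induction. *)
Inductive hull E : (T -> R) -> Prop :=
| hull_gen f : E f -> hull E f
| hull_lin a b f g : hull E f -> hull E g -> hull E (fun x => a * f x + b * g x)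
| hull_lim (u : nat -> T -> R) f M : (forall n, hull E (u n)) ->
    (forall n x, `|u n x| <= M) -> (forall x, u ^~ x @ \oo --> f x) ->
    hull E f.

Variable E : set (T -> R).
Hypothesis E1 : E (fun=> 1).
Hypothesis E_bounded : forall f, E f -> exists M, forall x, `|f x| <= M.
Hypothesis EM : forall f g, E f -> E g -> hull E (fun x => f x * g x).

Lemma hull_bounded f : hull E f -> exists M, forall x, `|f x| <= M.
Proof.
elim=> {f} [f /E_bounded//|a b f g _ [M fM] _ [N gN]|u f M _ _ uM uf].
- exists (`|a| * M + `|b| * N) => x.
  by rewrite (le_trans (ler_normD _ _))// !normrM lerD// ler_wpM2l.
- exists M => x; apply: cvgr_to_le (cvg_norm (uf x)) _.
  exact: nearW.
Qed.

Lemma hull_cst c : hull E (fun=> c).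
Proof.
have := hull_lin c 0 (hull_gen E1) (hull_gen E1).
by congr hull; apply/funext => x; rewrite mulr1 mul0r addr0.
Qed.

Lemma hullZ a f : hull E f -> hull E (fun x => a * f x).
Proof.
move=> hf; have := hull_lin a 0 hf hf.
by congr hull; apply/funext => x; rewrite mul0r addr0.
Qed.

Lemma hullD f g : hull E f -> hull E g -> hull E (fun x => f x + g x).
Proof.
move=> hf hg; have := hull_lin 1 1 hf hg.
by congr hull; apply/funext => x; rewrite !mul1r.
Qed.

Lemma hullB f g : hull E f -> hull E g -> hull E (fun x => f x - g x).
Proof.
move=> hf hg; have := hull_lin 1 (-1) hf hg.
by congr hull; apply/funext => x; rewrite mul1r mulN1r.
Qed.

(** The usual two-step bootstrap: for fixed g, the functions f whose product with
    g stays in the closure form a class closed under the same operations.  This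
    is applied with g in E, then with g in the closure. *)
Lemma hullM f g : hull E f -> hull E g -> hull E (fun x => f x * g x).
Proof.
have step g0 : hull E g0 -> (forall f0, E f0 -> hull E (fun x => f0 x * g0 x)) ->
    forall f0, hull E f0 -> hull E (fun x => f0 x * g0 x).
  move=> hg0 Eg0 f0; elim=> {f0} [//|a b f0 f1 _ h0 _ h1|u f0 M _ hu uM uf0].
    have := hull_lin a b h0 h1.
    by congr hull; apply/funext => x; rewrite mulrDl !mulrA.
  have [N gN] := hull_bounded hg0.
  apply: (@hull_lim _ (fun n x => u n x * g0 x) _ (M * N)) => // [n x|x].
    by rewrite normrM ler_pM.
  by apply: cvgM; [exact: uf0|exact: cvg_cst].
move=> hf hg; apply: (step g) => // f0 Ef0.
have := step f0 (hull_gen Ef0) _ g hg.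
have -> : (fun x => g x * f0 x) = (fun x => f0 x * g x).
  by apply/funext => x; rewrite mulrC.
by apply=> f1 Ef1; exact: EM.
Qed.

(** Polynomials p_0 = 0, p_(n+1) = p_n + (x^2 - p_n^2) / 2, which increase to the
    absolute value on the interval from -1 to 1.  They make the closure a
    lattice without an appeal to the Weierstrass theorem. *)
Fixpoint abs_iter n (x : R) : R :=
  if n is n'.+1 then abs_iter n' x + (x ^+ 2 - abs_iter n' x ^+ 2) / 2 else 0.

(** The error |x| - p_n is multiplied at each step by 1 - (|x| + p_n) / 2, which
    lies between 0 and 1 - |x| / 2. *)
Lemma abs_iter_bounds n (x : R) : `|x| <= 1 ->
  0 <= `|x| - abs_iter n x <= `|x| * (1 - `|x| / 2) ^+ n /\ 0 <= abs_iter n x.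
Proof.
move=> x1; elim: n => [|n [/andP[n1 n2] n0]] /=.
  by rewrite subr0 expr0 mulr1 normr_ge0 lexx.
set s := abs_iter n x in n0 n1 n2 *.
have -> : `|x| - (s + (x ^+ 2 - s ^+ 2) / 2) =
    (`|x| - s) * (1 - (`|x| + s) / 2).
  by rewrite -(@real_normK _ x) ?num_real//; field.
have a0 := normr_ge0 x.
split.
  apply/andP; split; first by rewrite mulr_ge0//; lra.
  rewrite exprSr mulrA ler_pM//; lra.
by rewrite addr_ge0// divr_ge0// -(@real_normK _ x) ?num_real//; nra.
Qed.

Lemma abs_iter_cvg (x : R) : `|x| <= 1 -> abs_iter ^~ x @ \oo --> `|x|.
Proof.
move=> x1; have [->|x0] := eqVneq x 0.
  rewrite normr0; apply: cvg_near_cst; apply: nearW => n.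
  elim: n => //= n ->; by rewrite expr0n/= subrr mul0r addr0.
have a0 : 0 < `|x| by rewrite normr_gt0.
apply/subr_cvg0.
have /cvg_geometric gx : `|1 - `|x| / 2| < 1 by rewrite ltr_norml; lra.
apply: (@squeeze_cvgr _ _ _ _
    (fun n => - (`|x| * (1 - `|x| / 2) ^+ n)) (fun=> 0)).
- apply: nearW => n; have [/andP[n1 n2] _] := abs_iter_bounds n x1.
  by rewrite /= lerNl opprB n2 subr_le0 -subr_ge0 n1.
- by rewrite -[X in _ --> X]oppr0; apply: cvgN; exact: gx.
- exact: cvg_cst.
Qed.

Lemma hull_abs f : hull E f -> hull E (fun x => `|f x|).
Proof.
move=> hf; have [M fM] := hull_bounded hf.
pose N := `|M| + 1.
have N0 : 0 < N by rewrite ltr_wpDl.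
have fN1 x : `|f x / N| <= 1.
  rewrite normrM normfV (gtr0_norm N0) ler_pdivrMr// mul1r.
  by rewrite (le_trans (fM x))// (le_trans (ler_norm _))// lerDl.
suff : hull E (fun x => `|f x / N|).
  move/(hullZ N); congr hull; apply/funext => x.
  by rewrite normrM normfV (gtr0_norm N0) mulrC divfK ?gt_eqF.
apply: (@hull_lim _ (fun n x => abs_iter n (f x / N)) _ 1) => [n|n x|x].
- elim: n => [|n ih] /=; first exact: hull_cst.
  apply: hullD => //.
  have hfN : hull E (fun x => f x / N).
    have := hullZ N^-1 hf.
    by congr hull; apply/funext => x; rewrite mulrC.
  have := hullZ 2^-1 (hullB (hullM hfN hfN) (hullM ih ih)).
  by congr hull; apply/funext => x; rewrite mulrC !expr2.
- have [/andP[n1 n2] n0] := abs_iter_bounds n (fN1 x).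
  by rewrite ger0_norm// (le_trans _ (fN1 x))// -subr_ge0.
- exact: abs_iter_cvg.
Qed.

Lemma hull_min f g : hull E f -> hull E g ->
  hull E (fun x => Num.min (f x) (g x)).
Proof.
move=> hf hg; have := hullZ 2^-1 (hullB (hullD hf hg) (hull_abs (hullB hf hg))).
by congr hull; apply/funext => x; rewrite minr_absE mulrC.
Qed.

Lemma hull_max f g : hull E f -> hull E g ->
  hull E (fun x => Num.max (f x) (g x)).
Proof.
move=> hf hg; have := hullZ 2^-1 (hullD (hullD hf hg) (hull_abs (hullB hf hg))).
by congr hull; apply/funext => x; rewrite maxr_absE mulrC.
Qed.

(** The increasing limit of min(1, n max(f, 0)). *)
Lemma hull_indic_gt0 f : hull E f -> hull E \1_[set x | 0 < f x].
Proof.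
move=> hf.
apply: (@hull_lim _ (fun n x => Num.min 1 (n%:R * Num.max (f x) 0)) _ 1).
- move=> n; apply: hull_min; first exact: hull_cst.
  by apply: hullZ; apply: hull_max => //; exact: hull_cst.
- move=> n x; rewrite ger0_norm ?ge_min ?lexx// le_min ler01/=.
  by rewrite mulr_ge0// le_max lexx orbT.
- move=> x; have [fx0|fx0] := leP (f x) 0.
    rewrite indicE memNset/= ?mulr0; last by rewrite ltNge fx0.
    by apply: cvg_near_cst; apply: nearW => n; rewrite mulr0 minEle ler10.
  rewrite indicE mem_set//; apply: cvg_near_cst.
  have [n0 _ n0f] := near_infty_natSinv_lt (PosNum fx0).
  exists n0.+1 => // -[//|n] /= n0n; apply/min_idPl.
  have := n0f n n0n; rewrite /= => /ltW.
  by rewrite invf_ple ?posrE// => h; rewrite -ler_pdivrMr// mul1r.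
Qed.

(** Indicators turn complements, finite unions and increasing unions into
    1 - f, maxima and bounded pointwise limits. *)
Lemma hull_sigma_algebra : sigma_algebra setT [set A | hull E \1_A].
Proof.
have hU A B : hull E \1_A -> hull E \1_B -> hull E \1_(A `|` B).
  move=> hA hB; have := hull_max hA hB; congr hull; apply/funext => x.
  rewrite !indicE in_setU.
  by case: (x \in A); case: (x \in B) => /=; rewrite /Num.max ?ltxx ?ltr01 ?ltr10.
have h0 : hull E \1_set0 by rewrite indic0; exact: hull_cst.
split => //= [A hA|A hA].
  have := hullB (hull_cst 1) hA; congr hull; apply/funext => x.
  rewrite setTD !indicE in_setC.
  by case: (x \in A); rewrite /= ?subrr ?subr0.
apply: (@hull_lim _ (fun n => \1_(\big[setU/set0]_(i < n) A i)) _ 1).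
- move=> n; elim: n => [|n ih]; first by rewrite big_ord0.
  by rewrite big_ord_recr/=; apply: hU.
- by move=> n x; rewrite indicE; case: (_ \in _); rewrite ?normr1 ?normr0 ?ler01.
- move=> x; rewrite indicE; case: (boolP (x \in _)) => [|xA].
    rewrite inE => -[k _ Akx]; apply: cvg_near_cst; exists k.+1 => // n /= kn.
    rewrite indicE mem_set//= -bigcup_mkord.
    by exists k.
  apply: cvg_near_cst; apply: nearW => n.
  rewrite indicE memNset//= -bigcup_mkord => -[k _ Akx].
  by move: xA; rewrite notin_setE; apply; exists k.
Qed.

End hull.

Section hull_measurable.
Context {R : realType} {disp : measure_display} {T : measurableType disp}.
Variable E : set (T -> R).
Hypothesis E1 : E (fun=> 1).
Hypothesis E_indic : forall A, measurable A -> hull E \1_A.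

Import HBNNSimple.

Lemma hull_nnsfun (f : {nnsfun T >-> R}) : hull E f.
Proof.
have -> : (f : T -> R) = (fun x => \sum_(y <- finmap.enum_fset (fset_set (range f)))
    y * \1_(f @^-1` [set y]) x).
  apply/funext => x; rewrite fimfunE fsbig_finite//.
elim: (finmap.enum_fset _) => [|y s ih].
  have := hull_cst E1 0.
  by congr hull; apply/funext => x; rewrite big_nil.
have := hullD (hullZ y (E_indic (measurable_sfunP f (measurable_set1 y)))) ih.
by congr hull; apply/funext => x; rewrite big_cons.
Qed.

(** After a shift making f nonnegative, its simple approximations are dominated
    by f, which keeps the limit bounded. *)
Lemma hull_bounded_measurable (f : T -> R) M :
  measurable_fun setT f -> (forall x, `|f x| <= M) -> hull E f.
Proof.
move=> mf fM.
pose g x := (f x + M)%:E.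
have mg : measurable_fun setT g.
  by apply/measurable_EFinP/measurable_funD.
have g0 x : setT x -> (0 <= g x)%E.
  by rewrite lee_fin -lerBlDr sub0r; have := fM x; rewrite ler_norml => /andP[].
suff : hull E (fun x => f x + M).
  move=> /hullB /(_ (hull_cst E1 M)); congr hull; apply/funext => x.
  by rewrite addrK.
apply: (@hull_lim _ _ _ (fun n => nnsfun_approx measurableT mg n) _ (M + M)).
- by move=> n; exact: hull_nnsfun.
- move=> n x; rewrite ger0_norm// nnsfun_approxE.
  have := le_approx n g0 (I : setT x); rewrite lee_fin => /le_trans; apply.
  by rewrite lerD2r (le_trans (ler_norm _)).
- move=> x; have := @cvg_nnsfun_approx _ _ _ _ measurableT _ mg g0 x I.
  by move/fine_cvg.
Qed.

End hull_measurable.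

(** * Trigonometric functions generate the bounded Borel functions *)

Section trigonometric.
Context {R : realType} {d : nat}.
Notation V := 'rV[R]_d.

Definition trig : set (V -> R) :=
  [set f | exists t, f = (fun x => cos (dot t x)) \/ f = (fun x => sin (dot t x))].

Lemma dot0l (x : V) : dot 0 x = 0.
Proof. by rewrite /dot big1// => i _; rewrite mxE mul0r. Qed.

Lemma dotDl (s t x : V) : dot (s + t) x = dot s x + dot t x.
Proof. by rewrite /dot -big_split/=; apply: eq_bigr => i _; rewrite mxE mulrDl. Qed.

Lemma dotZl a (t x : V) : dot (a *: t) x = a * dot t x.
Proof. by rewrite /dot big_distrr/=; apply: eq_bigr => i _; rewrite mxE mulrA. Qed.

Lemma dotC (s t : V) : dot s t = dot t s.
Proof. by apply: eq_bigr => i _; rewrite mulrC. Qed.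

Lemma dotDr (x s t : V) : dot x (s + t) = dot x s + dot x t.
Proof. by rewrite dotC dotDl !(dotC x). Qed.

Lemma dotZr a (x t : V) : dot x (a *: t) = a * dot x t.
Proof. by rewrite dotC dotZl dotC. Qed.

Lemma dotBl (s t x : V) : dot (s - t) x = dot s x - dot t x.
Proof. by rewrite -scaleN1r dotDl dotZl mulN1r. Qed.

Lemma dot_delta (i : 'I_d) (x : V) : dot (delta_mx ord0 i) x = x ord0 i.
Proof.
rewrite /dot (bigD1 i)//= mxE !eqxx mul1r big1 ?addr0// => j ji.
by rewrite mxE (negbTE ji) mul0r.
Qed.

Lemma trig1 : trig (fun=> 1).
Proof.
by exists 0; left; apply/funext => x; rewrite dot0l cos0.
Qed.

Lemma trig_bounded f : trig f -> exists M, forall x, `|f x| <= M.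
Proof.
by move=> [t [->|->]]; exists 1 => x; [exact: cos_max|exact: sin_max].
Qed.

(** The product-to-sum formulas. *)
Lemma trigM f g : trig f -> trig g -> hull trig (fun x => f x * g x).
Proof.
have hc t : hull trig (fun x => cos (dot t x)) by apply: hull_gen; exists t; left.
have hs t : hull trig (fun x => sin (dot t x)) by apply: hull_gen; exists t; right.
move=> [s [->|->]] [t [->|->]].
- have := hull_lin 2^-1 2^-1 (hc (s + t)) (hc (s - t)).
  congr hull; apply/funext => x; rewrite dotBl dotDl cosB cosD; by field.
- have := hull_lin 2^-1 (- 2^-1) (hs (s + t)) (hs (s - t)).
  congr hull; apply/funext => x; rewrite dotBl dotDl sinB sinD; by field.
- have := hull_lin 2^-1 2^-1 (hs (s + t)) (hs (s - t)).
  congr hull; apply/funext => x; rewrite dotBl dotDl sinB sinD; by field.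
- have := hull_lin 2^-1 (- 2^-1) (hc (s - t)) (hc (s + t)).
  congr hull; apply/funext => x; rewrite dotBl dotDl cosB cosD; by field.
Qed.

(** The derivative of sin at 0.  It is used twice: to recover coordinates from
    bounded trigonometric functions, and in the limit of (1 - cos(Hx)) / H^2. *)
Lemma cvg_sin_natmul (a : R) : n.+1%:R * sin (a / n.+1%:R) @[n --> \oo] --> a.
Proof.
have [->|a0] := eqVneq a 0.
  by apply: cvg_near_cst; apply: nearW => n; rewrite mul0r sin0 mulr0.
have [+ sin'] := is_derive_sin (0 : R).
rewrite /derivable sin0 => /cvg_ex[/= l].
rewrite cos0 in sin'.
move=> h; have l1 : l = 1.
  rewrite -sin'; apply/esym/cvg_lim => //; rewrite sin0; exact: h.
move: h; rewrite {}l1 => h.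
have h2 : (a / n.+1%:R)^-1 * sin (a / n.+1%:R) @[n --> \oo] --> (1 : R).
  move/cvgr_dnbhsP : h => /(_ (fun n => a / n.+1%:R)).
  have u0 : (forall n : nat, a / n.+1%:R != 0) /\ a / n.+1%:R @[n --> \oo] --> 0.
    split => [n|]; first by rewrite mulf_neq0// invr_neq0.
    rewrite -[X in _ --> X](mulr0 a); apply: cvgM; first exact: cvg_cst.
    exact: (@cvg_harmonic R).
  move/(_ u0); apply: cvg_trans; apply: near_eq_cvg; apply: nearW => n.
  by rewrite /= addr0 subr0 scaler1.
rewrite -[X in _ --> X]mulr1.
suff -> : (fun n => n.+1%:R * sin (a / n.+1%:R)) =
  (fun n => a * ((a / n.+1%:R)^-1 * sin (a / n.+1%:R))).
  by apply: cvgM => //; exact: cvg_cst.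
by apply/funext => n; rewrite invf_div mulrA [a * (_ / a)]mulrC divfK.
Qed.

(** The coordinate x_i is the pointwise limit of the functions n sin(x_i / n), which lie
    in the closure.  Hence the identity map is measurable from the
    sigma-algebra of the sets whose indicator lies in the closure to the
    Borel one. *)
Lemma trig_hull_indic (A : set V) : measurable A -> hull trig \1_A.
Proof.
pose S := [set A : set V | hull trig \1_A].
have sS : sigma_algebra setT S by exact: hull_sigma_algebra trig1 trig_bounded trigM.
pose W := g_sigma_algebraType S.
have mh (f : V -> R) : hull trig f -> @measurable_fun _ _ W R setT f.
  move=> hf; apply: (measurability _ (RGenOInfty.measurableE R)).
  move=> _ [_ [a ->] <-]; rewrite setTI; apply: sub_sigma_algebra; rewrite /S/=.
  have := hull_indic_gt0 trig1 trig_bounded trigM (hullB hf (hull_cst trig1 a)).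
  congr (hull _ \1_ _); apply/seteqP; split => x /=; by rewrite in_itv/= andbT subr_gt0.
(* Each n sin(x_i / n) is bounded, but not uniformly in n: the limit is taken
   among measurable functions, not in the closure. *)
have mid : @measurable_fun _ _ W V setT id.
  apply: measurable_coord_rV => i.
  apply: (@measurable_fun_cvg _ W _ _
    (fun n (x : V) => n.+1%:R * sin (x ord0 i / n.+1%:R))) => [n|x _].
    apply: mh; apply: hullZ; apply: hull_gen.
    exists (n.+1%:R^-1 *: delta_mx ord0 i); right; apply/funext => x.
    by rewrite dotZl dot_delta mulrC.
  exact: cvg_sin_natmul.
move=> mA.
have := mid measurableT A mA; rewrite setTI /=.
by rewrite /measurable/= sigma_algebra_id.
Qed.

Lemma trig_hull (f : V -> R) M :
  measurable_fun setT f -> (forall x, `|f x| <= M) -> hull trig f.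
Proof.
exact: (hull_bounded_measurable trig1 trig_hull_indic).
Qed.

End trigonometric.

(** * Densities and sigma-finiteness *)

(** The discontinuity at 0 is confined to one measurable point. *)
Lemma measurable_invr {R : realType} : measurable_fun setT (fun x : R => x^-1).
Proof.
rewrite -(setvU [set (0 : R)]); apply/measurable_funU => //.
  exact: measurableC.
split; last exact: measurable_fun_set1.
apply: open_continuous_measurable_fun.
  by apply: closed_openC; exact: closed_eq.
by move=> x; rewrite inE/= => /eqP x0; apply: inv_continuous.
Qed.

Section density.
Context {d1 d2 : measure_display} {S : measurableType d1} {T : measurableType d2}
        {R : realType}.
Variables (m : {measure set T -> \bar R}) (mu : {measure set S -> \bar R}).
Variables (h : S -> T) (phi : S -> R).
Hypothesis mh : measurable_fun setT h.
Hypothesis mphi : measurable_fun setT phi.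
Hypothesis phi0 : forall x, 0 <= phi x.
Hypothesis m_phi : forall A, measurable A -> (m A = \int[mu]_(x in h @^-1` A) (phi x)%:E)%E.

Import HBNNSimple.
Local Open Scope ereal_scope.

(** Monotone convergence reduces the formula to indicators, where it is the
    hypothesis on m.  The map h is there because the two measures may be carried
    by different measurable structures: Lebesgue measure lives on a copy of the
    real line whose sigma-algebra is generated by intervals. *)
Lemma ge0_integral_density (f : T -> \bar R) : measurable_fun setT f ->
  (forall x, 0 <= f x) -> \int[m]_x f x = \int[mu]_x (f (h x) * (phi x)%:E).
Proof.
move=> mf f0; pose u := nnsfun_approx measurableT mf.
have mphiE : measurable_fun setT (EFin \o phi) by exact/measurable_EFinP.
have -> : \int[m]_x f x = lim (\int[m]_x (EFin \o u n) x @[n --> \oo]).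
  have fE x : f x = lim ((EFin \o u n) x @[n --> \oo]).
    by apply/esym/cvg_lim => //; exact: cvg_nnsfun_approx.
  under eq_integral => x _ do rewrite fE.
  apply: monotone_convergence => //.
  - by move=> n; exact/measurable_EFinP.
  - by move=> n x _ //=; rewrite lee_fin.
  - by move=> x _ a b ab; rewrite lee_fin; exact/lefP/nd_nnsfun_approx.
have -> : \int[mu]_x (f (h x) * (phi x)%:E) =
    lim (\int[mu]_x ((EFin \o u n) (h x) * (phi x)%:E) @[n --> \oo]).
  have fg x : f (h x) * (phi x)%:E = lim ((EFin \o u n) (h x) * (phi x)%:E @[n --> \oo]).
    apply/esym/cvg_lim => //; apply: cvgeZr => //.
    exact: cvg_nnsfun_approx.
  under eq_integral => x _ do rewrite fg.
  apply: monotone_convergence => [//| | |].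
  - by move=> n; apply/emeasurable_funM => //; apply/measurable_EFinP; exact: measurableT_comp.
  - by move=> n x _ /=; rewrite mule_ge0 ?lee_fin.
  - move=> x _ a b ab/=; rewrite lee_wpmul2r ?lee_fin//.
    exact/lefP/nd_nnsfun_approx.
suff suf n : \int[m]_x (EFin \o u n) x = \int[mu]_x ((EFin \o u n) (h x) * (phi x)%:E).
  by under eq_fun do rewrite suf.
transitivity (\int[m]_x
   (\sum_(y \in range (u n)) (y * \1_(u n @^-1` [set y]) x)%:E)).
  by apply: eq_integral => t tE; rewrite /= fimfunE -fsumEFin.
have indich r : measurable_fun setT (fun x => (r * \1_(u n @^-1` [set r]) x)%:E).
  by apply: (measurable_comp measurableT) => //; exact: measurable_funM.
rewrite ge0_integral_fsum//; last by move=> y x _; exact: nnfun_muleindic_ge0.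
transitivity (\int[mu]_x (\sum_(y \in range (u n))
    (y * \1_(u n @^-1` [set y]) (h x))%:E * (phi x)%:E)); last first.
  apply: eq_integral => x xE.
  rewrite -ge0_mule_fsuml => [|y]; last exact: nnfun_muleindic_ge0.
  by rewrite fsumEFin // -(fimfunE _ (h x)).
rewrite ge0_integral_fsum//; last 2 first.
  - by move=> y; apply: emeasurable_funM => //; exact: (measurableT_comp (indich y)).
  - by move=> y x _; apply: mule_ge0; [exact: nnfun_muleindic_ge0|rewrite lee_fin].
apply: eq_fsbigr => r; rewrite inE => -[t _ rhn].
under eq_integral do rewrite EFinM.
rewrite integralZl_indic_nnsfun => //.
under [RHS]eq_integral do rewrite EFinM -muleA.
rewrite ge0_integralZl//; last 3 first.
- apply: emeasurable_funM => //; apply/measurable_EFinP.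
  by apply: (measurableT_comp _ mh).
- by move=> x _; rewrite mule_ge0 ?lee_fin.
- by rewrite -rhn lee_fin.
congr (_ * _).
under [RHS]eq_integral do rewrite muleC.
rewrite [RHS](eq_integral ((EFin \o phi) \_ (h @^-1` (u n @^-1` [set r])))); last first.
  by move=> x xE; rewrite epatch_indic.
by rewrite -integral_mkcond -m_phi// integral_indic// setIT.
Qed.

(** Multiplication by a nonnegative density commutes with positive and negative
    parts. *)
Lemma integral_density (f : T -> \bar R) : measurable_fun setT f ->
  \int[m]_x f x = \int[mu]_x (f (h x) * (phi x)%:E).
Proof.
move=> mf; rewrite integralE [RHS]integralE.
rewrite !ge0_integral_density//; [|exact: measurable_funeneg|exact: measurable_funepos].
congr (_ - _); apply: eq_integral => x _.
- by rewrite !funeposE maxe_pMl ?lee_fin// mul0e.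
- by rewrite !funenegE maxe_pMl ?lee_fin// mul0e mulNe.
Qed.

End density.

(** By Markov's inequality each set where g exceeds 1/(n+1) has finite measure. *)
Lemma sigma_finite_integrable {disp} {T : measurableType disp} {R : realType}
    (mu : {measure set T -> \bar R}) (g : T -> R) :
  measurable_fun setT g -> (forall x, 0 <= g x) ->
  mu [set x | g x = 0] = 0%E -> (\int[mu]_x (g x)%:E < +oo)%E ->
  sigma_finite setT mu.
Proof.
move=> mg g0 gz gi.
pose F n := [set x | g x = 0] `|` [set x | n.+1%:R^-1 <= g x].
have mz : measurable [set x | g x = 0].
  rewrite -[X in measurable X]setTI; exact: (mg measurableT [set 0]).
have mF n : measurable [set x | n.+1%:R^-1 <= g x].
  rewrite [X in measurable X](_ : _ = setT `&` g @^-1` `[n.+1%:R^-1, +oo[); last first.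
    by rewrite setTI; apply/seteqP; split => x /=; rewrite in_itv/= andbT.
  exact: mg.
exists F.
  apply/seteqP; split => // x _.
  have := g0 x; rewrite le_eqVlt => /predU1P[gx|gx]; first by exists 0%N => //; left.
  have [n _ ng] := near_infty_natSinv_lt (PosNum gx).
  by exists n => //; right; apply/ltW/(ng n)/leqnn.
move=> n; split; first exact: measurableU.
rewrite (le_lt_trans (measureU2 _ _ _))// [X in (X + _)%E]gz add0e.
have n0 : 0 < n.+1%:R^-1 :> R by rewrite invr_gt0.
have : (n.+1%:R^-1%:E * mu [set x | (n.+1%:R^-1 <= g x)%R] <= \int[mu]_x (g x)%:E)%E.
  rewrite -integral_cst//; apply: (@le_trans _ _
    (\int[mu]_(x in [set x | (n.+1%:R^-1 <= g x)%R]) (g x)%:E)%E).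
    apply: ge0_le_integral => //.
    + by move=> x _; rewrite lee_fin ltW.
    + by apply/measurable_funTS/measurable_EFinP.
  apply: ge0_subset_integral => //; first exact/measurable_EFinP.
  by move=> x _; rewrite lee_fin.
move=> /le_lt_trans => /(_ _ gi).
by rewrite lte_pdivrMl// => /lt_le_trans; apply; exact: leey.
Qed.

(** Replaces a measure by an equal one that carries its sigma-finiteness, as
    products and Fubini's theorem require. *)
Lemma ex_sigma_finite {disp} {T : measurableType disp} {R : realType}
    (mu : {measure set T -> \bar R}) : sigma_finite setT mu ->
  exists mu' : {sigma_finite_measure set T -> \bar R}, mu = mu' :> {measure set T -> \bar R}.
Proof.
move=> smu.
pose H := isSigmaFinite.Build _ _ _ _ smu.
pose H1 := isSFinite.Build _ _ _ _ (sfinite_measure_sigma_finite smu).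
pose mu' := HB.pack_for (SigmaFiniteMeasure.type T R) (Measure.sort mu) H1 H.
by exists mu'; exact: eq_measure.
Qed.

(** * Euclidean vectors and the orthant *)

Section vector_measurability.
Context {R : realType} {d : nat}.
Notation V := 'rV[R]_d.
Context {disp : measure_display} {T : measurableType disp}.
Implicit Types f g : T -> V.

Lemma measurable_coord_comp f i : measurable_fun setT f ->
  measurable_fun setT (fun t => f t ord0 i).
Proof. by move=> mf; exact: measurableT_comp (measurable_coord i) mf. Qed.

Lemma measurable_dot f g : measurable_fun setT f -> measurable_fun setT g ->
  measurable_fun setT (fun t => dot (f t) (g t)).
Proof.
move=> mf mg; apply: measurable_sum => i.
by apply: measurable_funM; exact: measurable_coord_comp.
Qed.

Lemma measurable_addrV f g : measurable_fun setT f -> measurable_fun setT g ->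
  measurable_fun setT (fun t => f t + g t).
Proof.
move=> mf mg; apply: measurable_coord_rV => i.
under eq_fun do rewrite mxE.
by apply: measurable_funD; exact: measurable_coord_comp.
Qed.

Lemma measurable_scaleV (k : T -> R) f : measurable_fun setT k -> measurable_fun setT f ->
  measurable_fun setT (fun t => k t *: f t).
Proof.
move=> mk mf; apply: measurable_coord_rV => i.
under eq_fun do rewrite mxE.
by apply: measurable_funM => //; exact: measurable_coord_comp.
Qed.

End vector_measurability.

Section orthant.
Context {R : realType} {d : nat}.
Notation V := 'rV[R]_d.
Implicit Types (s u : V).

Lemma measurable_enorm : measurable_fun setT (@enorm R d).
Proof.
rewrite /enorm; apply: measurableT_comp.
  by apply: continuous_measurable_fun; exact: sqrt_continuous.
exact: measurable_dot.
Qed.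

Lemma dot_ge0 u : 0 <= dot u u.
Proof. by apply: sumr_ge0 => i _; rewrite -expr2 sqr_ge0. Qed.

Lemma enorm_ge0 u : 0 <= enorm u.
Proof. exact: sqrtr_ge0. Qed.

Lemma enorm0 : enorm (0 : V) = 0.
Proof. by rewrite /enorm dot0l sqrtr0. Qed.

Lemma enorm_eq0 u : enorm u = 0 -> u = 0.
Proof.
move=> u0; apply/rowP => i; rewrite mxE; apply/eqP; rewrite -sqrf_eq0 eq_le sqr_ge0 andbT.
have <- : dot u u = 0.
  by apply/eqP; rewrite eq_le dot_ge0 andbT -sqrtr_eq0; exact/eqP.
rewrite /dot (bigD1 i)//= expr2 lerDl; apply: sumr_ge0 => j _.
by rewrite -expr2 sqr_ge0.
Qed.

Lemma enormZ (a : R) u : enorm (a *: u) = `|a| * enorm u.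
Proof.
by rewrite /enorm dotZl dotZr mulrA -expr2 sqrtrM ?sqr_ge0// sqrtr_sqr.
Qed.

Lemma coord_le_enorm u i : `|u ord0 i| <= enorm u.
Proof.
rewrite -sqrtr_sqr /enorm ler_sqrt ?dot_ge0//.
rewrite /dot (bigD1 i)//= expr2 lerDl; apply: sumr_ge0 => j _.
by rewrite -expr2 sqr_ge0.
Qed.

Lemma measurable_orthant : measurable (@orthant R d).
Proof.
rewrite [X in measurable X](_ : _ = \bigcap_(i in [set: 'I_d])
    (setT `&` (fun u : V => u ord0 i) @^-1` `[0, +oo[)); last first.
  apply/seteqP; split => [u u0 i _|u h i].
    by split => //=; rewrite in_itv/= andbT; exact: u0.
  by have [_] := h i I; rewrite /= in_itv/= andbT.
apply: fin_bigcap_measurable => // i _.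
exact: measurable_coord.
Qed.

Lemma measurable_set0V : measurable [set (0 : V)].
Proof.
rewrite [X in measurable X](_ : _ = setT `&` @enorm R d @^-1` [set 0]).
  exact: measurable_enorm.
by rewrite setTI; apply/seteqP; split => [u ->|u /enorm_eq0]; rewrite /= ?enorm0.
Qed.

Lemma measurable_orthant_neq0 : measurable (@orthant_neq0 R d).
Proof. by apply: measurableD; [exact: measurable_orthant|exact: measurable_set0V]. Qed.

Lemma orthantZ (z : R) s : 0 < z -> orthant s -> orthant (z *: s).
Proof. by move=> z0 s0 i; rewrite mxE mulr_ge0// ltW. Qed.

Lemma orthant_neq0Z (z : R) s : 0 < z -> orthant_neq0 s -> orthant_neq0 (z *: s).
Proof.
move=> z0 [s0 sN0]; split; first exact: orthantZ.
by move=> /eqP; rewrite scaler_eq0 gt_eqF//= => /eqP.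
Qed.

End orthant.

Lemma sigma_finite_enorm {R : realType} {d : nat} (mu : {measure set 'rV[R]_d -> \bar R}) :
  mu [set 0] = 0%E -> (\int[mu]_s (enorm s)%:E < +oo)%E -> sigma_finite setT mu.
Proof.
move=> mu0; apply: sigma_finite_integrable.
- exact: measurable_enorm.
- exact: enorm_ge0.
rewrite (_ : [set _ | _] = [set 0])//.
by apply/seteqP; split => s /=; [exact: enorm_eq0|move=> ->; rewrite enorm0].
Qed.

(** * Integration against the Levy measure *)

Section levy_integral.
Context {R : realType} {d : nat}.
Notation V := 'rV[R]_d.
Notation leb := (@lebesgue_measure R).
Local Open Scope ereal_scope.

Lemma integral_gamma_levy (f : R -> \bar R) : measurable_fun setT f ->
  \int[@gamma_levy R]_z f z =
  \int[leb]_(z in `]0%R, +oo[) (f z * (expR (- z) / z)%:E).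
Proof.
move=> mf; transitivity (\int[leb]_z (f z * (gamma_levy_density z)%:E)).
  apply: (@integral_density _ _ (measurableTypeR R) R R _ leb id) => //.
  - exact: measurable_gamma_levy_density.
  - exact: gamma_levy_density_ge0.
rewrite [RHS]integral_mkcond; apply: eq_integral => z _.
rewrite /gamma_levy_density !patchE; case: ifPn => //.
by rewrite mule0.
Qed.

Lemma integral_gamma_levyE (f : R -> R) : measurable_fun setT f ->
  \int[@gamma_levy R]_z (f z)%:E =
  \int[leb]_(z in `]0%R, +oo[) (f z * (expR (- z) / z))%:E.
Proof.
move=> mf; rewrite integral_gamma_levy; first by under eq_integral do rewrite -EFinM.
exact/measurable_EFinP.
Qed.

Variable nu : {sigma_finite_measure set V -> \bar R}.
Notation Pi := (levy_measure nu).

Lemma ge0_integral_levy (g : V -> \bar R) : measurable_fun setT g ->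
  (forall y, 0 <= g y) ->
  \int[Pi]_y g y = \int[nu]_s \int[@gamma_levy R]_z g (z *: s).
Proof.
move=> mg g0; rewrite /levy_measure.
have := @ge0_integral_pushforward _ _ _ _ R _ measurable_ray (nu \x @gamma_levy R)
  setT g measurableT mg (fun y _ => g0 y).
rewrite preimage_setT => h.
rewrite [LHS](_ : _ = \int[pushforward (nu \x @gamma_levy R) (@ray R d)]_y g y)//.
rewrite h fubini_tonelli1//; last by move=> p; exact: g0.
by apply: measurableT_comp => //; exact: measurable_ray.
Qed.

Hypothesis nu_orthant : nu (~` orthant) = 0.
Hypothesis nu0 : nu [set 0%R] = 0.

Lemma ae_orthant_neq0 : {ae nu, forall s, orthant_neq0 s}.
Proof.
have mO : measurable (~` @orthant R d) by apply: measurableC; exact: measurable_orthant.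
have m0 : measurable [set (0 : V)%R] by exact: measurable_set0V.
exists (~` @orthant R d `|` [set (0 : V)%R]); split.
- exact: measurableU.
- apply/eqP; rewrite -measure_le0 (le_trans (measureU2 _ mO m0))//.
  by rewrite [X in X + _]nu_orthant [X in _ + X]nu0 adde0.
- move=> s /= ns; have [so|] := pselect (orthant s); last by left.
  by right; apply: contrapT => s0; apply: ns.
Qed.

(** The iterated integrals of this development are only controlled for nonzero s in
    the orthant: at s = 0 the ray is constant and g(0) is arbitrary. *)
Lemma integral_orthant (F G : V -> \bar R) : measurable_fun setT F ->
  (forall s, orthant_neq0 s -> F s = G s) ->
  \int[nu]_s F s = \int[nu]_(s in orthant) G s.
Proof.
move=> mF FG.
have mG : measurable_fun orthant G.
  rewrite [X in measurable_fun X](_ : _ = orthant_neq0 `|` (orthant `&` [set 0%R])).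
    apply/measurable_funU.
    - exact: measurable_orthant_neq0.
    - by apply: measurableI; [exact: measurable_orthant|exact: measurable_set0V].
    split.
    - apply: (eq_measurable_fun F); last exact: measurable_funTS.
      by move=> s; rewrite inE => /FG.
    - apply: (measurable_funS measurable_set0V); first exact: subIsetr.
      exact: measurable_fun_set1.
  by rewrite /orthant_neq0 setUC setUIDK.
rewrite [RHS]integral_mkcond; apply: ae_eq_integral => //.
  by apply/(measurable_restrictT _ measurable_orthant).
apply: filterS ae_orthant_neq0 => s so _.
by rewrite patchE mem_set ?FG//; case: so.
Qed.

End levy_integral.

(** * The Frullani integrals *)

Section frullani.
Context {R : realType}.
Notation leb := (@lebesgue_measure R).
Notation gam := (@gamma_levy R).

(** The derivative of e^(-z) k(z) is e^(-z) (k'(z) - k(z)).  Positivity of the latter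
    is the form in which the fundamental theorem on a half-line applies. *)
Lemma integral_expRN_primitive (k k' : R -> R) (M : R) :
  (forall z, is_derive (z : R) (1 : R) k (k' z)) -> continuous k' ->
  (forall z, 0 <= k' z - k z) -> (forall z, `|k z| <= M) ->
  (\int[leb]_(z in `]0%R, +oo[) (expR (- z) * (k' z - k z))%:E = (- k 0)%:E)%E.
Proof.
move=> dk ck' k0 kM.
have cE : continuous (fun z : R => expR (- z)).
  by move=> z; apply: continuous_comp; [exact: opp_continuous|exact: continuous_expR].
have dE (z : R) : is_derive (z : R) (1 : R) (fun z => expR (- z)) (- expR (- z)).
  have h := is_derive1_comp (is_derive_expR (- z)) (is_deriveNid z 1).
  by apply: is_derive_eq h _; rewrite mulrN1.
have dK z : is_derive (z : R) (1 : R) (fun z => expR (- z) * k z) (expR (- z) * (k' z - k z)).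
  apply: is_derive_eq (is_deriveM (dE z) (dk z)) _.
  by rewrite /GRing.scale/=; ring.
have ck : continuous k.
  move=> z; apply/differentiable_continuous/derivable1_diffP.
  by have [] := dk z.
have cf : continuous (fun z => expR (- z) * (k' z - k z)).
  move=> z; apply: cvgM; first exact: cE.
  by apply: cvgB; [exact: ck'|exact: ck].
rewrite integral_itv_obnd_cbnd; last first.
  apply/measurable_funTS/measurable_EFinP; exact: continuous_measurable_fun.
rewrite (@ge0_continuous_FTC2y R _ (fun z => expR (- z) * k z) 0 0).
- by rewrite oppr0 expR0 mul1r -EFinB sub0r.
- by move=> z _; rewrite mulr_ge0 ?expR_ge0.
- exact: continuous_subspaceT.
- apply: norm_cvg0.
  apply: (@squeeze_cvgr _ _ _ _ (fun=> 0) (fun x => expR (- x) * M)).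
  + apply: nearW => x; rewrite normr_ge0 normrM gtr0_norm ?expR_gt0//=.
    by rewrite ler_pM2l ?expR_gt0.
  + exact: cvg_cst.
  + rewrite -[X in _ --> X](mul0r M); apply: cvgM; last exact: cvg_cst.
    exact: cvgr_expR.
- by move=> z _; have [] := dK z.
- apply: cvg_at_right_filter; apply: cvgM; [exact: cE|exact: ck].
- by move=> z _; rewrite derive1E; have [_ ->] := dK z.
Qed.

Lemma integral_expRN : (\int[leb]_(z in `]0%R, +oo[) (expR (- z))%:E = 1)%E.
Proof.
have dk (z : R) : is_derive (z : R) (1 : R) (fun=> -1 : R) 0 by exact: is_derive_cst.
have k0 (z : R) : 0 <= 0 - (-1) :> R by rewrite sub0r opprK.
have kM (z : R) : `|-1 : R| <= 1 by rewrite normrN1.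
have := @integral_expRN_primitive (fun=> -1) (fun=> 0) 1 dk _ k0 kM.
rewrite opprK => <-; last exact: cst_continuous.
by apply: eq_integral => z _; rewrite add0r mulr1.
Qed.

Lemma is_derive_cosM (u z : R) : is_derive (z : R) (1 : R) (fun z => cos (z * u)) (- u * sin (z * u)).
Proof.
have du : is_derive (z : R) (1 : R) (fun z : R => z * u) u.
  apply: is_derive_eq (is_deriveM (is_derive_id z 1) (is_derive_cst u z 1)) _.
  by rewrite /GRing.scale/= mulr0 add0r mulr1.
have h := @is_derive1_comp R cos (fun z => z * u) z _ _ (is_derive_cos _) du.
by apply: is_derive_eq h _; ring.
Qed.

Lemma is_derive_sinM (u z : R) : is_derive (z : R) (1 : R) (fun z => sin (z * u)) (u * cos (z * u)).
Proof.
have du : is_derive (z : R) (1 : R) (fun z : R => z * u) u.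
  apply: is_derive_eq (is_deriveM (is_derive_id z 1) (is_derive_cst u z 1)) _.
  by rewrite /GRing.scale/= mulr0 add0r mulr1.
have h := @is_derive1_comp R sin (fun z => z * u) z _ _ (is_derive_sin _) du.
by apply: is_derive_eq h _; ring.
Qed.

Lemma continuous_cosM (u : R) : continuous (fun z : R => cos (z * u)).
Proof.
by move=> z; apply: continuous_comp; [exact: mulrr_continuous|exact: continuous_cos].
Qed.

Lemma continuous_sinM (u : R) : continuous (fun z : R => sin (z * u)).
Proof.
by move=> z; apply: continuous_comp; [exact: mulrr_continuous|exact: continuous_sin].
Qed.

Lemma integrable_expRN (f : R -> R) (M : R) : measurable_fun setT f ->
  (forall z, `|f z| <= M) ->
  leb.-integrable `]0, +oo[ (fun z => (expR (- z) * f z)%:E).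
Proof.
move=> mf fM.
have mE : measurable_fun setT (fun z : R => expR (- z)).
  by apply: continuous_measurable_fun => z; apply: continuous_comp;
    [exact: opp_continuous|exact: continuous_expR].
have iE : leb.-integrable `]0, +oo[ (fun z => M%:E * (expR (- z))%:E)%E.
  apply: integrableZl => //; apply/integrableP; split.
    by apply/measurable_funTS/measurable_EFinP.
  under eq_integral do rewrite gee0_abs ?lee_fin ?expR_ge0//.
  by rewrite integral_expRN ltry.
apply: le_integrable iE => //.
  by apply/measurable_funTS/measurable_EFinP/measurable_funM.
move=> z _; rewrite -EFinM lee_fin normrM mulrC normrM.
rewrite ler_wpM2r//; apply: (le_trans (fM z)); exact: ler_norm.
Qed.

(** A function f bounded by 1 need not be positive, so k is replaced by k - 1,
    which amounts to integrating e^(-z) (1 + f), and the integral of e^(-z) is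
    subtracted. *)
Lemma integral_expRN_trig (f k k' : R -> R) :
  continuous f -> (forall z, `|f z| <= 1) ->
  (forall z : R, is_derive (z : R) (1 : R) k (k' z)) ->
  (exists M, forall z, `|k z| <= M) -> (forall z, k' z - k z = f z) ->
  (\int[leb]_(z in `]0%R, +oo[) (expR (- z) * f z) = - k 0)%R.
Proof.
move=> cf f1 dk [M kM] kf.
have dk1 (z : R) : is_derive (z : R) (1 : R) (fun z => k z - 1) (k' z).
  by apply: is_derive_eq (is_deriveB (dk z) (is_derive_cst (1 : R) z (1 : R))) _; rewrite subr0.
have k1M z : `|k z - 1| <= M + 1.
  by rewrite (le_trans (ler_normB _ _))// normr1 lerD2r.
have ck z : {for z, continuous k}.
  by apply/differentiable_continuous/derivable1_diffP; have [] := dk z.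
have ck' : continuous k'.
  have -> : k' = (fun z => f z + k z) by apply/funext => z; rewrite -kf subrK.
  by move=> z; apply: cvgD; [exact: cf|exact: ck].
have kf1 z : k' z - (k z - 1) = 1 + f z by rewrite -kf; ring.
have k10 z : 0 <= k' z - (k z - 1).
  by rewrite kf1; have := f1 z; rewrite ler_norml; lra.
have := integral_expRN_primitive dk1 ck' k10 k1M.
under eq_integral do rewrite kf1 mulrDr mulr1.
have mf : measurable_fun setT f by exact: continuous_measurable_fun.
have i1 : leb.-integrable `]0%R, +oo[ (fun z => (expR (- z))%:E).
  have := @integrable_expRN (fun=> 1) 1.
  by under [X in _.-integrable _ X]eq_fun do rewrite mulr1; apply => // z; rewrite normr1.
have i2 := integrable_expRN mf f1.
rewrite integralD_EFin// integral_expRN /Rintegral.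
have /fineK <- : (\int[leb]_(z in `]0%R, +oo[) (expR (- z) * f z)%:E)%E \is a fin_num.
  exact: integrable_fin_num.
rewrite -EFinD => -[] /eqP; rewrite -subr_eq0 => /eqP h.
by rewrite -[LHS]subr0 -[X in _ - X]h; ring.
Qed.

Lemma integral_expRN_cos (u : R) :
  (\int[leb]_(z in `]0%R, +oo[) (expR (- z) * cos (z * u)) = (1 + u ^+ 2)^-1)%R.
Proof.
have u1 : 1 + u ^+ 2 != 0 by rewrite gt_eqF// ltr_pwDl// sqr_ge0.
pose c := (1 + u ^+ 2)^-1.
(* The bounded solution of k' - k = cos(uz), by undetermined coefficients. *)
pose k z := c * (u * sin (z * u) - cos (z * u)).
pose k' z := c * (u * (u * cos (z * u)) - (- u * sin (z * u))).
have dk z : is_derive (z : R) (1 : R) k (k' z).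
  exact: (is_deriveZ c (is_deriveB (is_deriveZ u (is_derive_sinM u z)) (is_derive_cosM u z))).
have kM : exists M, forall z, `|k z| <= M.
  exists (`|c| * (`|u| * 1 + 1)) => z; rewrite normrM ler_wpM2l//.
  by rewrite (le_trans (ler_normB _ _))// normrM lerD ?cos_max// ler_wpM2l// sin_max.
have kf z : k' z - k z = cos (z * u) by rewrite /k' /k /c; field.
rewrite (integral_expRN_trig (@continuous_cosM u) (fun=> cos_max _) dk kM kf).
by rewrite /k mul0r sin0 cos0 mulr0 sub0r mulrN1 opprK.
Qed.

Lemma integral_expRN_sin (u : R) :
  (\int[leb]_(z in `]0%R, +oo[) (expR (- z) * sin (z * u)) = u / (1 + u ^+ 2))%R.
Proof.
have u1 : 1 + u ^+ 2 != 0 by rewrite gt_eqF// ltr_pwDl// sqr_ge0.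
pose c := - (1 + u ^+ 2)^-1.
(* The bounded solution of k' - k = sin(uz). *)
pose k z := c * (u * cos (z * u) + sin (z * u)).
pose k' z := c * (u * (- u * sin (z * u)) + u * cos (z * u)).
have dk z : is_derive (z : R) (1 : R) k (k' z).
  exact: (is_deriveZ c (is_deriveD (is_deriveZ u (is_derive_cosM u z)) (is_derive_sinM u z))).
have kM : exists M, forall z, `|k z| <= M.
  exists (`|c| * (`|u| * 1 + 1)) => z; rewrite normrM ler_wpM2l//.
  by rewrite (le_trans (ler_normD _ _))// normrM lerD ?sin_max// ler_wpM2l// cos_max.
have kf z : k' z - k z = sin (z * u) by rewrite /k' /k /c; field.
rewrite (integral_expRN_trig (@continuous_sinM u) (fun=> sin_max _) dk kM kf).
by rewrite /k /c mul0r sin0 cos0 mulr1 addr0 mulNr opprK mulrC.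
Qed.

End frullani.

Section is_derive_integral.
Context {R : realType} {disp : measure_display} {Y : measurableType disp}.
Variables (mu : {measure set Y -> \bar R}) (f f' : R -> Y -> R) (G : Y -> R).
Hypothesis intf : forall u, mu.-integrable setT (EFin \o f u).
Hypothesis df : forall (u : R) y, is_derive (u : R) (1 : R) (f ^~ y) (f' u y).
Hypothesis intG : mu.-integrable setT (EFin \o G).
Hypothesis f'G : forall u y, `|f' u y| <= G y.

(** Differentiation under the integral sign, with hypotheses global in the
    parameter so that no neighbourhood has to be carried along. *)
Lemma is_derive_integral (a : R) :
  is_derive (a : R) (1 : R) (fun u => \int[mu]_y f u y) (\int[mu]_y f' a y).
Proof.
have f'E u y : partial1of2 f u y = f' u y.
  by rewrite partial1of2E; have [_ ->] := df u y.
have aI : `]a - 1, a + 1[%classic a by rewrite /= in_itv/=; lra.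
have G0 y : 0 <= G y by rewrite (le_trans _ (f'G 0 y)).
have df1 u y : `]a - 1, a + 1[%classic u -> setT y -> derivable (f ^~ y) u 1.
  by move=> _ _; have [] := df u y.
have dG u y : `]a - 1, a + 1[%classic u -> setT y -> `|partial1of2 f u y| <= G y.
  by move=> _ _; rewrite f'E.
split.
- exact: (derivable_under_integral measurableT aI (fun u _ => intf u) df1 G0 intG dG).
- rewrite -derive1E.
  rewrite (differentiation_under_integral measurableT aI (fun u _ => intf u) df1 G0 intG dG).
  by apply: eq_Rintegral => y _; exact: f'E.
Qed.

End is_derive_integral.

Section trig_bounds.
Context {R : realType}.

Lemma normr_sin_le (x : R) : `|sin x| <= `|x|.
Proof.
wlog x0 : x / 0 <= x => [h|].
  have [/h//|/ltW x0] := leP 0 x.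
  by rewrite -normrN -sinN -(normrN x); apply: h; rewrite oppr_ge0.
have cs : {within `[0, x], continuous sin}.
  by apply: continuous_subspaceT => y; exact: continuous_sin.
have [c _] := MVT_segment x0 (fun y _ => is_derive_sin y) cs.
rewrite sin0 !subr0 => ->; rewrite normrM ler_piMl//; exact: cos_max.
Qed.

Lemma oneBcosE (x : R) : 1 - cos x = sin (x / 2) ^+ 2 *+ 2.
Proof.
have {1}-> : x = (x / 2) *+ 2 by rewrite -mulr_natr divfK.
by rewrite cos_mulr2n cos2sin2 mulrnBl opprB addrA -[1 + _ - _]addrA; ring.
Qed.

Lemma normr_cosB1_le (x : R) : `|cos x - 1| <= `|x|.
Proof.
rewrite distrC oneBcosE normrMn normrX.
have h1 := sin_max (x / 2); have h2 := normr_sin_le (x / 2).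
rewrite normrM (@gtr0_norm _ 2^-1)// in h2.
have := normr_ge0 (sin (x / 2)); rewrite mulr2n; nra.
Qed.

End trig_bounds.

Section frullani_integrals.
Context {R : realType}.
Notation leb := (@lebesgue_measure R).
Notation gam := (@gamma_levy R).

(** The factor |z| cancels the pole of e^(-z)/z.  Hence measurable functions bounded
    by a multiple of |z| are integrable. *)
Lemma integral_gamma_norm : (\int[gam]_z `|z|%:E = 1)%E.
Proof.
rewrite integral_gamma_levyE; last exact: normr_measurable.
rewrite -[RHS](@integral_expRN R); apply: eq_integral => z.
rewrite inE/= in_itv/= andbT => z0.
by rewrite gtr0_norm// mulrC divfK// gt_eqF.
Qed.

Lemma integrable_gamma (f : R -> R) (c : R) : measurable_fun setT f ->
  (forall z, `|f z| <= c * `|z|) -> gam.-integrable setT (EFin \o f).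
Proof.
move=> mf fc.
have ic : gam.-integrable setT (fun z => c%:E * `|z|%:E)%E.
  apply: integrableZl => //; apply/integrableP; split.
    by apply/measurable_EFinP; exact: normr_measurable.
  under eq_integral do rewrite gee0_abs ?lee_fin ?normr_ge0//.
  by rewrite integral_gamma_norm ltry.
apply: le_integrable ic => //; first exact/measurable_EFinP.
by move=> z _; rewrite -EFinM lee_fin (le_trans (fc z))// ler_norm.
Qed.

Lemma measurable_cosM (u : R) : measurable_fun setT (fun z : R => cos (z * u)).
Proof. by apply: continuous_measurable_fun; exact: continuous_cosM. Qed.

Lemma measurable_sinM (u : R) : measurable_fun setT (fun z : R => sin (z * u)).
Proof. by apply: continuous_measurable_fun; exact: continuous_sinM. Qed.

Lemma integrable_gamma_cos (u : R) : gam.-integrable setT (fun z => (cos (z * u) - 1)%:E).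
Proof.
apply: (@integrable_gamma (fun z => cos (z * u) - 1) `|u|) => [|z].
  by apply: measurable_funB => //; exact: measurable_cosM.
by rewrite (le_trans (normr_cosB1_le _))// normrM mulrC.
Qed.

Lemma integrable_gamma_sin (u : R) : gam.-integrable setT (fun z => (sin (z * u))%:E).
Proof.
apply: (@integrable_gamma (fun z => sin (z * u)) `|u|) => [|z].
  exact: measurable_sinM.
by rewrite (le_trans (normr_sin_le _))// normrM mulrC.
Qed.

Let intG : gam.-integrable setT (EFin \o (fun z : R => `|z|)).
Proof.
apply: (@integrable_gamma _ 1) => [|z]; first exact: normr_measurable.
by rewrite mul1r normr_id.
Qed.

Lemma Rintegral_gamma (f : R -> R) : measurable_fun setT f ->
  (\int[gam]_z f z = \int[leb]_(z in `]0%R, +oo[) (f z * (expR (- z) / z)))%R.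
Proof. by move=> mf; rewrite /Rintegral integral_gamma_levyE. Qed.

(** Differentiating in u produces the factor z that cancels the pole of
    e^(-z)/z, which leaves an elementary integral. *)
Lemma is_derive_gamma_cos (u : R) : is_derive (u : R) (1 : R)
  (fun u => \int[gam]_z (cos (z * u) - 1))%R (- (u / (1 + u ^+ 2))).
Proof.
have df (v : R) z : is_derive (v : R) (1 : R) (fun v => cos (z * v) - 1) (- z * sin (z * v)).
  under eq_fun do rewrite mulrC.
  rewrite [in sin _]mulrC.
  by apply: is_derive_eq (is_deriveB (is_derive_cosM z v) (is_derive_cst (1 : R) v (1 : R))) _;
    rewrite subr0.
apply: is_derive_eq (is_derive_integral integrable_gamma_cos df intG _ u) _.
  by move=> v z; rewrite normrM normrN ler_piMr// sin_max.
rewrite Rintegral_gamma; last first.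
  by apply: continuous_measurable_fun => z; apply: cvgM;
    [exact: opp_continuous|exact: continuous_sinM].
rewrite -(@integral_expRN_sin R) -mulN1r -RintegralZl//; last first.
  apply: integrable_expRN (fun=> sin_max _); exact: measurable_sinM.
apply: eq_Rintegral => z; rewrite inE/= in_itv/= andbT => z0.
by field; rewrite gt_eqF.
Qed.

Lemma is_derive_gamma_sin (u : R) : is_derive (u : R) (1 : R)
  (fun u => \int[gam]_z sin (z * u))%R (1 + u ^+ 2)^-1.
Proof.
have df (v : R) z : is_derive (v : R) (1 : R) (fun v => sin (z * v)) (z * cos (z * v)).
  under eq_fun do rewrite mulrC.
  rewrite [in cos _]mulrC.
  exact: is_derive_sinM.
apply: is_derive_eq (is_derive_integral integrable_gamma_sin df intG _ u) _.
  by move=> v z; rewrite normrM ler_piMr// cos_max.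
rewrite Rintegral_gamma; last first.
  by apply: measurable_funM => //; exact: measurable_cosM.
rewrite -(@integral_expRN_cos R).
apply: eq_Rintegral => z; rewrite inE/= in_itv/= andbT => z0.
by field; rewrite gt_eqF.
Qed.

(** Real part of the Frullani integral: both sides vanish at 0 and have the same
    derivative. *)
Lemma gamma_cos (u : R) :
  (\int[gam]_z (cos (z * u) - 1) = - ln (Num.sqrt (1 + u ^+ 2)))%R.
Proof.
have pos (v : R) : 0 < 1 + v ^+ 2 by rewrite ltr_pwDl// sqr_ge0.
have -> : ln (Num.sqrt (1 + u ^+ 2)) = 2^-1 * ln (1 + u ^+ 2).
  rewrite -[in RHS](@sqr_sqrtr _ (1 + u ^+ 2)) ?ltW//.
  by rewrite lnXn ?sqrtr_gt0// -[ln _ *+ 2]mulr_natl mulKf.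
have dl (v : R) : is_derive (v : R) (1 : R) (fun u => ln (1 + u ^+ 2)) (2 * v / (1 + v ^+ 2)).
  have d2 : is_derive (v : R) (1 : R) (fun u => 1 + u ^+ 2) (2 * v).
    apply: is_derive_eq (is_deriveD (is_derive_cst (1 : R) v (1 : R))
      (is_deriveM (is_derive_id v (1 : R)) (is_derive_id v (1 : R)))) _.
    by rewrite /GRing.scale/=; ring.
  have h := @is_derive1_comp R (@ln R) (fun u => 1 + u ^+ 2) v _ _ (is_derive1_ln (pos v)) d2.
  by apply: is_derive_eq h _; rewrite mulrC.
have dh (v : R) : is_derive (v : R) (1 : R)
    (fun u => \int[gam]_z (cos (z * u) - 1) + 2^-1 * ln (1 + u ^+ 2))%R 0.
  apply: is_derive_eq (is_deriveD (is_derive_gamma_cos v) (is_deriveZ 2^-1 (dl v))) _.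
  by rewrite /GRing.scale/=; field; rewrite gt_eqF.
have := is_derive_0_is_cst u 0 dh.
rewrite expr0n/= addr0 ln1 mulr0 addr0.
rewrite [X in _ = X](_ : _ = 0) => [/eqP|]; first by rewrite addr_eq0 => /eqP.
under eq_Rintegral do rewrite mulr0 cos0 subrr.
by rewrite /Rintegral integral0.
Qed.

(** Imaginary part of the Frullani integral, by the same argument. *)
Lemma gamma_sin (u : R) : (\int[gam]_z sin (z * u) = atan u)%R.
Proof.
have dh (v : R) : is_derive (v : R) (1 : R)
    (fun u => \int[gam]_z sin (z * u) - atan u)%R 0.
  by apply: is_derive_eq (is_deriveB (is_derive_gamma_sin v) (is_derive1_atan v)) _;
    rewrite subrr.
have := is_derive_0_is_cst u 0 dh.
rewrite atan0 [X in _ = X - _](_ : _ = 0) ?subr0; first by move/eqP; rewrite subr_eq0 => /eqP.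
under eq_Rintegral do rewrite mulr0 sin0.
by rewrite /Rintegral integral0.
Qed.

End frullani_integrals.

(** * The Levy measure of a generalized gamma convolution *)

Section levy_measure_properties.
Context {R : realType} {d : nat}.
Notation V := 'rV[R]_d.
Notation leb := (@lebesgue_measure R).
Notation gam := (@gamma_levy R).
Variable nu : {sigma_finite_measure set V -> \bar R}.
Hypothesis nu_orthant : nu (~` orthant) = 0%E.
Hypothesis nu0 : nu [set 0] = 0%E.
Notation Pi := (levy_measure nu).
Local Open Scope ereal_scope.

(** Almost every s is a nonzero vector of the orthant, and then so is every z s
    with z > 0. *)
Lemma levy_measure_orthant : Pi (~` orthant_neq0) = 0.
Proof.
have mN : measurable (~` @orthant_neq0 R d).
  by apply: measurableC; exact: measurable_orthant_neq0.
transitivity (\int[Pi]_y (\1_(~` @orthant_neq0 R d) y)%:E).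
  by rewrite integral_indic// setIT.
rewrite ge0_integral_levy//; last by apply/measurable_EFinP.
have mI (s : V) : measurable_fun setT (fun z : R => (\1_(~` @orthant_neq0 R d) (z *: s))%:E).
  apply/measurable_EFinP; apply: (measurableT_comp (measurable_indic _)) => //.
  exact: measurable_scaleV.
rewrite (@integral_orthant _ _ nu nu_orthant nu0 _ (cst 0)).
- by rewrite integral0.
- have := @measurable_fun_fubini_tonelli_F _ _ _ _ R gam
    (fun p : V * R => (\1_(~` @orthant_neq0 R d) (p.2 *: p.1))%:E).
  apply; last by move=> p; rewrite lee_fin.
  apply/measurable_EFinP; apply: (measurableT_comp (measurable_indic _)) => //.
  exact: measurable_ray.
- move=> s s0; rewrite integral_gamma_levy//.
  apply: integral0_eq => z; rewrite /= in_itv/= andbT => z0.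
  rewrite indicE memNset ?mul0e//=; apply; exact: orthant_neq0Z.
Qed.

Lemma integral_levy_orthant (f : V -> \bar R) : measurable_fun setT f ->
  \int[Pi]_(y in orthant_neq0) f y = \int[Pi]_y f y.
Proof.
move=> mf; rewrite integral_mkcond; apply: ae_eq_integral => //.
  by apply/(measurable_restrictT _ measurable_orthant_neq0); exact: measurable_funTS.
exists (~` orthant_neq0); split => //.
- by apply: measurableC; exact: measurable_orthant_neq0.
- exact: levy_measure_orthant.
- by move=> y /= h yD; apply: h => _; rewrite patchE mem_set.
Qed.

(** The function g is extended by 0 outside the punctured orthant before Tonelli's
    theorem is applied.  Infinite values are allowed, because g will be an
    expectation not yet known to be finite. *)
Lemma ge0_integral_levy_orthant (g : V -> \bar R) : measurable_fun orthant_neq0 g ->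
  (forall y, orthant_neq0 y -> 0 <= g y) ->
  \int[Pi]_(y in orthant_neq0) g y =
  \int[nu]_(s in orthant) \int[leb]_(z in `]0%R, +oo[) (g (z *: s) * (expR (- z) / z)%:E).
Proof.
move=> mg g0; rewrite integral_mkcond.
have mg' : measurable_fun setT (g \_ orthant_neq0).
  by apply/(measurable_restrictT _ measurable_orthant_neq0).
have g'0 y : 0 <= (g \_ orthant_neq0) y.
  by rewrite patchE; case: ifPn => //; rewrite inE => /g0.
rewrite ge0_integral_levy//; apply: (integral_orthant nu_orthant nu0).
  apply: (@measurable_fun_fubini_tonelli_F _ _ _ _ R gam
    (fun p : V * R => (g \_ orthant_neq0) (p.2 *: p.1))) => //.
  by apply: measurableT_comp => //; exact: measurable_ray.
move=> s s0; rewrite integral_gamma_levy; last first.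
  by apply: measurableT_comp => //; exact: measurable_scaleV.
apply: eq_integral => z; rewrite inE/= in_itv/= andbT => z0.
by rewrite patchE mem_set//; exact: orthant_neq0Z.
Qed.

(** Here the total mass 1 of e^(-z) dz appears. *)
Lemma levy_measure_moment : \int[Pi]_y (enorm y)%:E = \int[nu]_s (enorm s)%:E.
Proof.
rewrite ge0_integral_levy//; last 2 first.
- by apply/measurable_EFinP; exact: measurable_enorm.
- by move=> y; rewrite lee_fin enorm_ge0.
apply: eq_integral => s _.
under eq_integral do rewrite enormZ EFinM.
rewrite ge0_integralZr// ?lee_fin ?enorm_ge0//; last first.
  by apply/measurable_EFinP; exact: normr_measurable.
by rewrite integral_gamma_norm mul1e.
Qed.

Lemma integrable_ray (f : V -> R) : measurable_fun setT f ->
  Pi.-integrable setT (EFin \o f) -> (nu \x gam).-integrable setT (EFin \o (f \o @ray R d)).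
Proof.
move=> mf /integrableP[_ fi]; apply/integrableP; split.
  by apply/measurable_EFinP; apply: measurableT_comp => //; exact: measurable_ray.
rewrite fubini_tonelli1//; last first.
  apply/measurable_EFinP; apply: measurableT_comp => //.
  by apply: measurableT_comp => //; exact: measurable_ray.
move: fi; rewrite ge0_integral_levy//.
by apply/measurable_EFinP; apply: measurableT_comp.
Qed.

(** Real-valued iterated integrals send infinite or undefined inner integrals to
    0, but by Fubini's theorem this concerns only a null set of vectors s. *)
Lemma Rintegral_levy (f : V -> R) : measurable_fun setT f ->
  Pi.-integrable setT (EFin \o f) ->
  (\int[Pi]_(y in orthant_neq0) f y =
   \int[nu]_(s in orthant) \int[leb]_(z in `]0%R, +oo[) (f (z *: s)%R * (expR (- z) / z)))%R.
Proof.
move=> mf fi; have fi' := integrable_ray mf fi.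
have mfr : measurable_fun setT (f \o @ray R d).
  by apply: measurableT_comp => //; exact: measurable_ray.
rewrite /Rintegral integral_levy_orthant; last exact/measurable_EFinP.
congr fine.
have -> : \int[Pi]_y (f y)%:E = \int[nu \x gam]_p (f (ray p))%:E.
  have := @integral_pushforward _ _ _ _ R _ measurable_ray (nu \x gam)%E setT (EFin \o f) _ _ measurableT.
  rewrite preimage_setT; apply => //; exact/measurable_EFinP.
rewrite -(integral12_prod_meas1 fi').
have mF := measurable_fubini_F fi'.
transitivity (\int[nu]_s (fine (fubini_F gam (EFin \o (f \o @ray R d)) s))%:E).
  apply: ae_eq_integral => //.
    by apply/measurable_EFinP; apply: measurableT_comp.
  have /integrable_ae := integrable_fubini_F fi'.
  move=> /(_ measurableT); apply: filterS => s /= /(_ I) sf _.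
  by rewrite fineK.
apply: (integral_orthant nu_orthant nu0).
  by apply/measurable_EFinP; apply: measurableT_comp.
move=> s _; rewrite /fubini_F/= integral_gamma_levyE//.
by rewrite /ray/=; apply: (measurableT_comp mf); exact: measurable_scaleV.
Qed.

End levy_measure_properties.

Section dot_bounds.
Context {R : realType} {d : nat}.
Notation V := 'rV[R]_d.

Lemma normr_dot_le (t y : V) : `|dot t y| <= (\sum_(i < d) `|t ord0 i|) * enorm y.
Proof.
rewrite (le_trans (ler_norm_sum _ _ _))// big_distrl/=.
by apply: ler_sum => i _; rewrite normrM ler_wpM2l// coord_le_enorm.
Qed.

Lemma normr_atan_le (x : R) : `|atan x| <= `|x|.
Proof.
wlog x0 : x / 0 <= x => [h|].
  have [/h//|/ltW x0] := leP 0 x.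
  by rewrite -normrN -atanN -(normrN x); apply: h; rewrite oppr_ge0.
have cs : {within `[0, x], continuous atan}.
  by apply: continuous_subspaceT => y; exact: continuous_atan.
have [c _] := MVT_segment x0 (fun y _ => is_derive1_atan y) cs.
rewrite atan0 !subr0 => ->; rewrite normrM ler_piMl// ger0_norm ?invr_ge0.
  by rewrite invf_le1 ?lerDl ?sqr_ge0// ltr_pwDl// sqr_ge0.
by rewrite addr_ge0// sqr_ge0.
Qed.

Lemma integrable_le_enorm (mu : {measure set V -> \bar R}) (f : V -> R) (c : R) :
  (\int[mu]_y (enorm y)%:E < +oo)%E -> measurable_fun setT f ->
  (forall y, `|f y| <= c * enorm y) -> mu.-integrable setT (EFin \o f).
Proof.
move=> mu1 mf fc.
have ic : mu.-integrable setT (fun y => c%:E * (enorm y)%:E)%E.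
  apply: integrableZl => //; apply/integrableP; split.
    by apply/measurable_EFinP; exact: measurable_enorm.
  by under eq_integral do rewrite gee0_abs ?lee_fin ?enorm_ge0//.
apply: le_integrable ic => //; first exact/measurable_EFinP.
by move=> y _; rewrite -EFinM lee_fin (le_trans (fc y))// ler_norm.
Qed.

Lemma measurable_cos_dot (t : V) : measurable_fun setT (fun y => cos (dot t y)).
Proof.
apply: (measurableT_comp (continuous_measurable_fun (@continuous_cos R))).
exact: measurable_dot.
Qed.

Lemma measurable_sin_dot (t : V) : measurable_fun setT (fun y => sin (dot t y)).
Proof.
apply: (measurableT_comp (continuous_measurable_fun (@continuous_sin R))).
exact: measurable_dot.
Qed.

Lemma integrable_cos_dot (mu : {measure set V -> \bar R}) (t : V) :
  (\int[mu]_y (enorm y)%:E < +oo)%E -> mu.-integrable setT (fun y => (cos (dot t y) - 1)%:E).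
Proof.
move=> mu1; apply: (@integrable_le_enorm mu (fun y => cos (dot t y) - 1) _ mu1).
  by apply: measurable_funB => //; exact: measurable_cos_dot.
by move=> y; apply: le_trans (normr_cosB1_le _) (normr_dot_le t y).
Qed.

Lemma integrable_sin_dot (mu : {measure set V -> \bar R}) (t : V) :
  (\int[mu]_y (enorm y)%:E < +oo)%E -> mu.-integrable setT (fun y => (sin (dot t y))%:E).
Proof.
move=> mu1; apply: (@integrable_le_enorm mu (fun y => sin (dot t y)) _ mu1).
  exact: measurable_sin_dot.
by move=> y; apply: le_trans (normr_sin_le _) (normr_dot_le t y).
Qed.

End dot_bounds.

Section complex_logarithm.
Context {R : realType}.
Local Open Scope complex_scope.

Lemma cmod_oneBi (u : R) : cmod (1 -i* u) = Num.sqrt (1 + u ^+ 2).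
Proof. by rewrite /cmod/= expr1n sqrrN. Qed.

(** The number 1 - i u has modulus sqrt(1 + u^2) and cos(atan u) is the inverse of
    that, so acos returns |atan u|; the sign is that of the imaginary part -u. *)
Lemma carg_oneBi (u : R) : carg (1 -i* u) = - atan u.
Proof.
rewrite /carg cmod_oneBi/= div1r -cos_atan oppr_ge0; case: ifPn => u0.
  rewrite cosKN//; apply/andP; split.
    by rewrite (le_trans _ (ltW (atan_gtNpi2 u)))// lerN2 ler_pdivrMr// ler_peMr ?pi_ge0// ler1n.
  by rewrite -(@atan0 R) le_atan.
rewrite cosK// in_itv/=; apply/andP; split.
  by rewrite -(@atan0 R) le_atan// ltW// ltNge.
by rewrite (le_trans (ltW (atan_ltpi2 u)))// ler_pdivrMr// ler_peMr ?pi_ge0// ler1n.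
Qed.

End complex_logarithm.

Section log_chf.
Context {R : realType} {d : nat}.
Notation V := 'rV[R]_d.
Notation leb := (@lebesgue_measure R).
Variable nu : {sigma_finite_measure set V -> \bar R}.
Hypothesis nu_orthant : nu (~` orthant) = 0%E.
Hypothesis nu0 : nu [set 0] = 0%E.
Hypothesis nu1 : (\int[nu]_s (enorm s)%:E < +oo)%E.
Notation Pi := (levy_measure nu).
Local Open Scope complex_scope.

Lemma levy_moment_lty : (\int[Pi]_y (enorm y)%:E < +oo)%E.
Proof. by rewrite levy_measure_moment. Qed.

Lemma Rintegral_levy_cos (t : V) :
  (\int[Pi]_(y in orthant_neq0) (cos (dot t y) - 1) =
   - \int[nu]_(s in orthant) ln (Num.sqrt (1 + dot s t ^+ 2)))%R.
Proof.
rewrite Rintegral_levy//; last 2 first.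
- by apply: measurable_funB => //; exact: measurable_cos_dot.
- by apply: integrable_cos_dot; exact: levy_moment_lty.
rewrite /Rintegral -fineN -integral_ge0N; last first.
  move=> s _; rewrite lee_fin ln_ge0// -[leLHS]sqrtr1 ler_sqrt ?lerDl ?sqr_ge0//.
  by rewrite addr_ge0// sqr_ge0.
congr fine; apply: eq_integral => s _; rewrite -EFinN; congr EFin.
rewrite -gamma_cos Rintegral_gamma.
  by apply: eq_Rintegral => z _; rewrite dotZr dotC.
by apply: measurable_funB => //; exact: measurable_cosM.
Qed.

Lemma Rintegral_levy_sin (t : V) :
  (\int[Pi]_(y in orthant_neq0) sin (dot t y) =
   \int[nu]_(s in orthant) atan (dot s t))%R.
Proof.
rewrite Rintegral_levy//; last 2 first.
- exact: measurable_sin_dot.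
- by apply: integrable_sin_dot; exact: levy_moment_lty.
apply: eq_Rintegral => s _.
rewrite -gamma_sin Rintegral_gamma; last exact: measurable_sinM.
by apply: eq_Rintegral => z _; rewrite dotZr dotC.
Qed.

(** The Frullani integrals, integrated against nu. *)
Lemma log_chf_levy (t : V) :
  - cintegral nu orthant (fun s => clog (1 -i* dot s t)) =
  cintegral Pi orthant_neq0 (fun y => cexp (0 +i* dot t y) - 1).
Proof.
rewrite /cintegral/=; apply/eqP; rewrite eq_complex/=; apply/andP; split; apply/eqP.
- under eq_Rintegral do rewrite cmod_oneBi.
  under [RHS]eq_Rintegral do rewrite expR0 mul1r.
  by rewrite Rintegral_levy_cos.
- under eq_Rintegral do rewrite carg_oneBi -mulN1r.
  under [RHS]eq_Rintegral do rewrite expR0 mul1r oppr0 addr0.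
  rewrite Rintegral_levy_sin RintegralZl ?mulN1r ?opprK//.
    exact: measurable_orthant.
  apply: (@integrableS _ _ _ _ setT) => //; first exact: measurable_orthant.
  apply: (integrable_le_enorm (c := \sum_(i < d) `|t ord0 i|) nu1).
    apply: measurableT_comp; last exact: measurable_dot.
    by apply: continuous_measurable_fun => x; exact: continuous_atan.
  by move=> s; rewrite (le_trans (normr_atan_le _))// dotC normr_dot_le.
Qed.

Lemma ggc_levy_measure {disp} {Omega : measurableType disp} (P : probability Omega R)
    (X : {RV P >-> V}) :
  is_log_chf P X (fun t => - cintegral nu orthant (fun s => clog (1 -i* dot s t))) ->
  is_levy_measure P X Pi.
Proof.
move=> hX; split.
- exact: levy_measure_orthant.
- move=> t; split; apply: (@integrableS _ _ _ _ setT) => //;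
    [exact: measurable_orthant_neq0| |exact: measurable_orthant_neq0|].
  + under eq_fun do rewrite /= expR0 mul1r.
    by apply: integrable_cos_dot; exact: levy_moment_lty.
  + under eq_fun do rewrite /= expR0 mul1r oppr0 addr0.
    by apply: integrable_sin_dot; exact: levy_moment_lty.
- rewrite (_ : (fun t => _) = (fun t => - cintegral nu orthant (fun s => clog (1 -i* dot s t))))//.
  by apply/funext => t; rewrite log_chf_levy.
Qed.

End log_chf.

(** * Fourier transforms determine signed measures *)

Section weighted_functional.
Context {R : realType} {d : nat} {disp : measure_display} {T : measurableType disp}.
Notation V := 'rV[R]_d.
Variables (mu : {measure set T -> \bar R}) (k : T -> R) (Z : T -> V).
Hypothesis ik : mu.-integrable setT (EFin \o k).
Hypothesis mZ : measurable_fun setT Z.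

(** The integral of h against the image under Z of the signed measure k mu. *)
Definition weighted (h : V -> R) : R := \int[mu]_x (k x * h (Z x)).

Let mk : measurable_fun setT k.
Proof. by apply/measurable_EFinP; exact: measurable_int ik. Qed.

Lemma integrable_weighted (h : V -> R) (M : R) : measurable_fun setT h ->
  (forall y, `|h y| <= M) -> mu.-integrable setT (fun x => (k x * h (Z x))%:E).
Proof.
move=> mh hM.
have iM : mu.-integrable setT (fun x => M%:E * (EFin \o k) x)%E by exact: integrableZl.
apply: le_integrable iM => //.
  apply/measurable_EFinP; apply: measurable_funM => //; exact: measurableT_comp.
move=> x _; rewrite -EFinM lee_fin !normrM mulrC ler_wpM2r//.
by rewrite (le_trans (hM _))// ler_norm.
Qed.

Lemma weighted_lin (a b : R) (f g : V -> R) (M N : R) :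
  measurable_fun setT f -> (forall y, `|f y| <= M) ->
  measurable_fun setT g -> (forall y, `|g y| <= N) ->
  weighted (fun y => a * f y + b * g y) = a * weighted f + b * weighted g.
Proof.
move=> mf fM mg gN; rewrite /weighted.
have i1 := integrable_weighted mf fM; have i2 := integrable_weighted mg gN.
rewrite -!RintegralZl// -RintegralD//; first by apply: eq_Rintegral => x _; ring.
- by apply: (integrableZl measurableT a) i1.
- by apply: (integrableZl measurableT b) i2.
Qed.

(** Dominated convergence, with dominating function M |k|. *)
Lemma weighted_cvg (u : nat -> V -> R) (f : V -> R) (M : R) :
  (forall n, measurable_fun setT (u n)) -> (forall n y, `|u n y| <= M) ->
  measurable_fun setT f -> (forall y, u ^~ y @ \oo --> f y) ->
  weighted (u n) @[n --> \oo] --> weighted f.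
Proof.
move=> mu_ uM mf uf; rewrite /weighted /Rintegral.
have fM y : `|f y| <= M.
  by apply: cvgr_to_le (cvg_norm (uf y)) _; exact: nearW.
apply: fine_cvg; rewrite fineK; last first.
  by apply: integrable_fin_num => //; exact: integrable_weighted mf fM.
have iM : mu.-integrable setT (fun x => `|M%:E * (EFin \o k) x|)%E.
  by apply: integrable_abse; exact: integrableZl.
apply: (@dominated_cvg _ _ _ mu setT measurableT
  (fun n x => (k x * u n (Z x))%:E) _ (fun x => `|M%:E * (EFin \o k) x|%E)) => //.
- by move=> n; exact: measurable_int (integrable_weighted (mu_ n) (uM n)).
- move=> x _; apply: cvg_EFin; first exact: nearW.
  by apply: cvgM; [exact: cvg_cst|exact: uf].
- move=> n x _; rewrite -EFinM lee_fin !normrM mulrC ler_wpM2r//.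
  by rewrite (le_trans (uM _ _))// ler_norm.
Qed.

End weighted_functional.

Lemma hull_trig_measurable {R : realType} {d : nat} (h : 'rV[R]_d -> R) :
  hull trig h -> measurable_fun setT h.
Proof.
elim=> {h} [f [t [->|->]]|a b f g _ mf _ mg|u f M _ mu uM uf].
- exact: measurable_cos_dot.
- exact: measurable_sin_dot.
- by apply: measurable_funD; exact: measurable_funM.
- by apply: (measurable_fun_cvg mu) => x _; exact: uf.
Qed.

Section fourier_uniqueness.
Context {R : realType} {d : nat} {d1 d2 : measure_display}
        {T1 : measurableType d1} {T2 : measurableType d2}.
Notation V := 'rV[R]_d.
Variables (mu1 : {measure set T1 -> \bar R}) (k1 : T1 -> R) (Z1 : T1 -> V).
Variables (mu2 : {measure set T2 -> \bar R}) (k2 : T2 -> R) (Z2 : T2 -> V).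
Hypothesis ik1 : mu1.-integrable setT (EFin \o k1).
Hypothesis ik2 : mu2.-integrable setT (EFin \o k2).
Hypothesis mZ1 : measurable_fun setT Z1.
Hypothesis mZ2 : measurable_fun setT Z2.
Hypothesis eq_cos : forall t,
  weighted mu1 k1 Z1 (fun y => cos (dot t y)) = weighted mu2 k2 Z2 (fun y => cos (dot t y)).
Hypothesis eq_sin : forall t,
  weighted mu1 k1 Z1 (fun y => sin (dot t y)) = weighted mu2 k2 Z2 (fun y => sin (dot t y)).

(** Agreement on the trigonometric functions propagates along the inductive
    definition of their closure.  The weights may change sign, which is why this is
    phrased with functionals rather than with measures. *)
Lemma fourier_uniqueness (h : V -> R) (M : R) : measurable_fun setT h ->
  (forall y, `|h y| <= M) -> weighted mu1 k1 Z1 h = weighted mu2 k2 Z2 h.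
Proof.
move=> mh hM; have : hull trig h by exact: trig_hull hM.
elim=> {mh hM M h} [f [t [->|->]]//|a b f g hf ef hg eg|u f M hu eu uM uf].
- have [M fM] := hull_bounded (@trig_bounded R d) hf.
  have [N gN] := hull_bounded (@trig_bounded R d) hg.
  have mf := hull_trig_measurable hf; have mg := hull_trig_measurable hg.
  by rewrite (weighted_lin ik1 mZ1 _ _ mf fM mg gN) (weighted_lin ik2 mZ2 _ _ mf fM mg gN) ef eg.
- have mu n := hull_trig_measurable (hu n).
  have mf := hull_trig_measurable (hull_lim hu uM uf).
  have c1 := weighted_cvg ik1 mZ1 mu uM mf uf.
  have c2 := weighted_cvg ik2 mZ2 mu uM mf uf.
  apply: (cvg_unique _ c1); rewrite //.
  suff -> : (fun n => weighted mu1 k1 Z1 (u n)) = (fun n => weighted mu2 k2 Z2 (u n)) by [].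
  exact/funext.
Qed.

End fourier_uniqueness.

(** * The Stein identity for a Levy measure with a first moment *)

Section product_integral.
Context {R : realType} {d1 d2 : measure_display}
        {T1 : measurableType d1} {T2 : measurableType d2}.
Variables (m1 : {sigma_finite_measure set T1 -> \bar R}).
Variables (m2 : {sigma_finite_measure set T2 -> \bar R}).

Lemma integrable_prod (f : T1 -> R) (g : T2 -> R) :
  m1.-integrable setT (EFin \o f) -> m2.-integrable setT (EFin \o g) ->
  (m1 \x m2)%E.-integrable setT (fun p => (f p.1 * g p.2)%:E).
Proof.
move=> fi gi.
have mf : measurable_fun setT f by apply/measurable_EFinP; exact: measurable_int fi.
have mg : measurable_fun setT g by apply/measurable_EFinP; exact: measurable_int gi.
have mfg : measurable_fun setT (fun p : T1 * T2 => (f p.1 * g p.2)%:E).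
  apply/measurable_EFinP; apply: measurable_funM.
  - exact: measurableT_comp.
  - exact: measurableT_comp.
apply/(integrable12ltyP _ _ mfg).
under eq_integral.
  move=> x _; under eq_integral do rewrite /= normrM EFinM.
  rewrite ge0_integralZl//; last first.
    by apply/measurable_EFinP; exact: measurableT_comp.
  over.
move/integrableP : fi => [_ fi]; move/integrableP : gi => [_ gi].
rewrite ge0_integralZr//; last 2 first.
- by apply/measurable_EFinP; exact: measurableT_comp.
- exact: integral_ge0.
apply: lte_mul_pinfty => //; first exact: integral_ge0.
by rewrite ge0_fin_numE//; exact: integral_ge0.
Qed.

Lemma Rintegral_prod (f : T1 -> R) (g : T2 -> R) :
  m1.-integrable setT (EFin \o f) -> m2.-integrable setT (EFin \o g) ->
  \int[(m1 \x m2)%E]_p (f p.1 * g p.2) = (\int[m1]_x f x) * (\int[m2]_y g y).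
Proof.
move=> fi gi; rewrite -RintegralZr// /Rintegral.
congr fine; rewrite -(integral12_prod_meas1 (integrable_prod fi gi)).
apply: eq_integral => x _; rewrite /fubini_F/=.
under eq_integral do rewrite EFinM.
rewrite integralZl// EFinM; congr (_ * _)%E.
by rewrite /Rintegral fineK//; exact: integrable_fin_num.
Qed.

End product_integral.

Lemma Rintegral_sum {disp} {T : measurableType disp} {R : realType}
    (mu : {measure set T -> \bar R}) (I : Type) (s : seq I) (g : I -> T -> R) :
  (forall i, mu.-integrable setT (EFin \o g i)) ->
  \int[mu]_x (\sum_(i <- s) g i x) = \sum_(i <- s) \int[mu]_x g i x.
Proof.
move=> ig; elim: s => [|i s ih].
  rewrite big_nil; under eq_Rintegral do rewrite big_nil.
  by rewrite /Rintegral integral0.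
rewrite big_cons -ih; under eq_Rintegral do rewrite big_cons.
rewrite RintegralD//.
have := @integrable_sum _ _ _ mu _ measurableT _ s xpredT _ (fun i _ => ig i).
by under [X in _.-integrable _ X]eq_fun do rewrite sumEFin.
Qed.

Section truncation.
Context {R : realType} {d : nat} {disp : measure_display} {T : measurableType disp}.
Notation V := 'rV[R]_d.
Variables (mu : {measure set T -> \bar R}) (k Z : T -> V) (f : V -> V).

(** Large values are replaced by 0 along the whole vector f(y), not coordinate by
    coordinate, so that a scalar product with the truncation is dominated by the scalar
    product with f. *)
Definition trunc (n : nat) (y : V) : V := \1_[set y | enorm (f y) <= n%:R] y *: f y.

Hypothesis mf : measurable_fun setT f.

Lemma measurable_trunc n : measurable_fun setT (trunc n).
Proof.
apply: measurable_scaleV => //; apply: measurable_indic.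
rewrite [X in measurable X](_ : _ = setT `&` (fun y => enorm (f y)) @^-1` `]-oo, n%:R]); last first.
  by rewrite setTI; apply/seteqP; split => y /=; rewrite in_itv/=.
by apply: (measurableT_comp measurable_enorm mf) => //; exact: measurable_itv.
Qed.

Lemma trunc_coord_le n y j : `|trunc n y ord0 j| <= n%:R.
Proof.
rewrite /trunc mxE indicE; have [|_] := boolP (y \in _); last by rewrite mul0r normr0.
by rewrite inE/= mul1r; apply: le_trans; exact: coord_le_enorm.
Qed.

Lemma trunc_eventually y : \forall n \near \oo, trunc n y = f y.
Proof.
exists (Num.truncn (enorm (f y))).+1 => // n /= ny.
rewrite /trunc indicE mem_set ?scale1r//=.
by rewrite (le_trans (ltW (truncnS_gt _)))// ler_nat.
Qed.

Hypothesis mk : measurable_fun setT k.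
Hypothesis mZ : measurable_fun setT Z.
Hypothesis ik : forall j, mu.-integrable setT (fun x => (k x ord0 j)%:E).
Hypothesis idot : mu.-integrable setT (fun x => (dot (k x) (f (Z x)))%:E).

(** The sum over the coordinates is taken before the limit, since
    <k, f(Z)> is integrable but its individual terms need not be. *)
Lemma cvg_trunc : \sum_(j < d) \int[mu]_x (k x ord0 j * trunc n (Z x) ord0 j) @[n --> \oo] -->
  \int[mu]_x dot (k x) (f (Z x)).
Proof.
have ikj n j : mu.-integrable setT (fun x => (k x ord0 j * trunc n (Z x) ord0 j)%:E).
  apply: (integrable_weighted (ik j) mZ (h := fun y => trunc n y ord0 j) (M := n%:R)).
    by apply: measurable_coord_comp; exact: measurable_trunc.
  by move=> y; exact: trunc_coord_le.
rewrite [X in X @ _ --> _](_ : _ = (fun n => \int[mu]_x dot (k x) (trunc n (Z x)))); last first.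
  apply/funext => n; rewrite -(Rintegral_sum _ (g := fun j x => k x ord0 j * trunc n (Z x) ord0 j))//.
  by move=> j; exact: ikj.
rewrite /Rintegral; apply: fine_cvg; rewrite fineK; last exact: integrable_fin_num.
apply: (@dominated_cvg _ _ _ mu setT measurableT
  (fun n x => (dot (k x) (trunc n (Z x)))%:E) _
  (fun x => `|(dot (k x) (f (Z x)))%:E|%E)) => //.
- move=> n; apply/measurable_EFinP; apply: measurable_dot => //.
  by apply: measurableT_comp => //; exact: measurable_trunc.
- move=> x _; apply: cvg_near_cst; near do rewrite (near (trunc_eventually (Z x)) _)//.
- exact: integrable_abse.
- move=> n x _; rewrite /trunc dotZr /= lee_fin normrM ler_piMl// indicE.
  by case: (_ \in _); rewrite ?normr1 ?normr0.
Unshelve. all: by end_near. Qed.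

End truncation.

Section stein_identity.
Context {R : realType} {d : nat} {disp : measure_display} {Omega : measurableType disp}.
Notation V := 'rV[R]_d.
Variables (P : probability Omega R) (X : {RV P >-> V}).
Variable Pi : {sigma_finite_measure set V -> \bar R}.
Hypothesis X0 : forall w, orthant (X w).
Hypothesis Pi1 : (\int[Pi]_y (enorm y)%:E < +oo)%E.

(** The real and imaginary parts of the logarithm of the characteristic function. *)
Let a (t : V) := \int[Pi]_y (cos (dot t y) - 1).
Let b (t : V) := \int[Pi]_y sin (dot t y).

Hypothesis chf_cos : forall t, \int[P]_w cos (dot t (X w)) = expR (a t) * cos (b t).
Hypothesis chf_sin : forall t, \int[P]_w sin (dot t (X w)) = expR (a t) * sin (b t).

Let mX : measurable_fun setT X. Proof. exact: measurable_funPT. Qed.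

Let mXj j : measurable_fun setT (fun w => X w ord0 j).
Proof. exact: measurable_coord_comp. Qed.

Let e (j : 'I_d) : V := delta_mx ord0 j.

Lemma integrable_coord_levy j : Pi.-integrable setT (fun y => (y ord0 j)%:E).
Proof.
apply: (integrable_le_enorm (c := 1) Pi1); first exact: measurable_coord.
by move=> y; rewrite mul1r coord_le_enorm.
Qed.

Lemma integrable_bounded (f : Omega -> R) (M : R) : measurable_fun setT f ->
  (forall w, `|f w| <= M) -> P.-integrable setT (EFin \o f).
Proof.
move=> mf fM; apply: measurable_bounded_integrable => //.
  by rewrite [ltLHS](@probability_setT _ _ _ P) ltry.
exists M; split; first exact: num_real.
by move=> x Mx w _ /=; rewrite (le_trans (fM w))// ltW.
Qed.

Lemma log_chf_re_le0 t : a t <= 0.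
Proof.
rewrite -oppr_ge0 /a -[X in _ <= X]mulN1r -RintegralZl//; last exact: integrable_cos_dot.
apply: Rintegral_ge0 => y _; rewrite mulN1r opprB subr_ge0; exact: cos_le1.
Qed.

Let C j := \int[Pi]_y `|y ord0 j|.

(** The imaginary part of the characteristic function at h e_j is
    exp(a) sin(b) with a <= 0, hence is at most |b| in absolute value, and b grows
    at most linearly in h. *)
Lemma normr_Esin_le j (h : R) : `|\int[P]_w sin (h * X w ord0 j)| <= `|h| * C j.
Proof.
have -> : \int[P]_w sin (h * X w ord0 j) = expR (a (h *: e j)) * sin (b (h *: e j)).
  by rewrite -chf_sin; apply: eq_Rintegral => w _; rewrite dotZl dot_delta.
rewrite normrM (le_trans (ler_piMl _ _))//.
  by rewrite ger0_norm ?expR_ge0// -expR0 ler_expR log_chf_re_le0.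
apply: (le_trans (normr_sin_le _)).
have ij := integrable_norm (integrable_coord_levy j).
rewrite /b (le_trans (le_normr_Rintegral measurableT _))//; first exact: integrable_sin_dot.
rewrite /C -RintegralZl//; apply: le_Rintegral => //.
- exact/integrable_norm/integrable_sin_dot.
- by apply: (integrableZl measurableT `|h|) ij.
- by move=> y _; rewrite dotZl dot_delta (le_trans (normr_sin_le _))// normrM.
Qed.

(** The value at X_j = 0 is 0, by the convention on inverses; this is also the
    limit of (1 - cos(hx)) / x as x tends to 0. *)
Let phi j (h : R) w := (1 - cos (h * X w ord0 j)) / X w ord0 j.

Let integrable_phi j h : P.-integrable setT (EFin \o phi j h).
Proof.
apply: (integrable_bounded (M := `|h|)) => [|w].
  apply: measurable_funM; last exact: (measurableT_comp measurable_invr).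
  apply: measurable_funB => //.
  apply: (measurableT_comp (continuous_measurable_fun (@continuous_cos R))).
  exact: measurable_funM.
rewrite /phi normrM normfV distrC.
have [->|x0] := eqVneq (X w ord0 j) 0; first by rewrite normr0 invr0 mulr0.
by rewrite ler_pdivrMr ?normr_gt0// (le_trans (normr_cosB1_le _))// normrM.
Qed.

(** As a function of h, the left-hand side vanishes at 0 and has derivative
    E sin(h X_j), which is at most C h; the mean value theorem concludes. *)
Lemma E_oneBcos_div_le j (H : R) : 0 < H ->
  \int[P]_w ((1 - cos (H * X w ord0 j)) / X w ord0 j) <= H ^+ 2 * C j.
Proof.
move=> H0.
have df (h : R) w : is_derive (h : R) (1 : R) (fun h => phi j h w) (sin (h * X w ord0 j)).
  rewrite /phi; have [x0|x0] := eqVneq (X w ord0 j) 0.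
    rewrite x0 mulr0 sin0 invr0; under eq_fun do rewrite mulr0.
    exact: is_derive_cst.
  under eq_fun do rewrite mulrC.
  apply: is_derive_eq (is_deriveZ _ (is_deriveB (is_derive_cst (1 : R) h (1 : R))
    (is_derive_cosM (X w ord0 j) h))) _.
  by rewrite /GRing.scale/= sub0r mulNr opprK mulKf.
have i1 : P.-integrable setT (EFin \o (fun _ : Omega => 1 : R)).
  by apply: (integrable_bounded (M := 1)) => // w; rewrite normr1.
have dF (h : R) : is_derive (h : R) (1 : R) (fun h => \int[P]_w phi j h w)
    (\int[P]_w sin (h * X w ord0 j)).
  by apply: (is_derive_integral (integrable_phi j) df i1) => u w; exact: sin_max.
have cF : {within `[0, H], continuous (fun h => \int[P]_w phi j h w)}.
  apply: continuous_subspaceT => h.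
  by apply/differentiable_continuous/derivable1_diffP; have [] := dF h.
have [c cH] := MVT_segment (ltW H0) (fun h _ => dF h) cF.
rewrite [X in _ - X](_ : _ = 0); last first.
  rewrite /phi; under eq_Rintegral do rewrite mul0r cos0 subrr mul0r.
  by rewrite /Rintegral integral0.
rewrite !subr0 /phi => ->.
move: cH; rewrite in_itv/= => /andP[c0 cH].
have C0 : 0 <= C j by apply: Rintegral_ge0.
rewrite (le_trans (ler_wpM2r (ltW H0) (le_trans (ler_norm _) (normr_Esin_le _ _))))//.
rewrite ger0_norm//; have := ler_wpM2r (ltW H0) (ler_wpM2r C0 cH).
by rewrite [H * C j * H]mulrAC -expr2.
Qed.

(** Differentiability of a characteristic function at 0 does not give a first moment
    in general.  Here X_j is nonnegative, so Fatou's lemma applies to the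
    quotients (1 - cos(H X_j)) / (H^2 X_j), which are bounded in mean and tend to X_j / 2
    as H tends to 0. *)
Lemma integrable_coord_X j : P.-integrable setT (fun w => (X w ord0 j)%:E).
Proof.
have X0j w : 0 <= X w ord0 j by exact: X0.
pose q n w := n.+1%:R ^+ 2 * phi j n.+1%:R^-1 w.
have q0 n w : 0 <= q n w.
  by rewrite mulr_ge0// ?exprn_ge0// divr_ge0// subr_ge0 cos_le1.
have iq n : P.-integrable setT (fun w => (q n w)%:E).
  by apply: (integrableZl measurableT (n.+1%:R ^+ 2)) (integrable_phi j n.+1%:R^-1).
have qC n : (\int[P]_w (q n w)%:E <= (C j)%:E)%E.
  have /fineK <- : (\int[P]_w (q n w)%:E \is a fin_num)%E by exact: integrable_fin_num.
  rewrite lee_fin -/(Rintegral _ _ _) RintegralZl//.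
  have n0 : 0 < n.+1%:R^-1 :> R by rewrite invr_gt0.
  rewrite (le_trans (ler_wpM2l _ (E_oneBcos_div_le j n0)))// mulrA -exprMn divff//.
  by rewrite expr1n mul1r.
(* By 1 - cos u = 2 sin(u/2)^2, with n sin(a/n) tending to a. *)
have qX w : q ^~ w @ \oo --> X w ord0 j / 2.
  have [x0|x0] := eqVneq (X w ord0 j) 0.
    by apply: cvg_near_cst; apply: nearW => n; rewrite /q /phi x0 invr0 mul0r !mulr0.
  have h := @cvg_sin_natmul R (X w ord0 j / 2).
  have -> : X w ord0 j / 2 = 2 / X w ord0 j * ((X w ord0 j / 2) * (X w ord0 j / 2)).
    by field.
  rewrite [X in X @ _ --> _](_ : _ = (fun n => 2 / X w ord0 j *
      ((n.+1%:R * sin (X w ord0 j / 2 / n.+1%:R)) * (n.+1%:R * sin (X w ord0 j / 2 / n.+1%:R))))).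
    by apply: cvgM; [exact: cvg_cst|exact: cvgM].
  apply/funext => n; rewrite /q /phi oneBcosE -[_ ^+ 2 *+ 2]mulr_natl.
  have -> : n.+1%:R^-1 * X w ord0 j / 2 = X w ord0 j / 2 / n.+1%:R by ring.
  by ring.
apply/integrableP; split; first exact/measurable_EFinP.
under eq_integral do rewrite gee0_abs ?lee_fin ?X0j//.
have qE w : limn_einf (fun n => (q n w)%:E) = (2^-1%:E * (X w ord0 j)%:E)%E.
  have h : (q n w)%:E @[n --> \oo] --> (2^-1%:E * (X w ord0 j)%:E)%E.
    by rewrite -EFinM mulrC; apply: cvg_EFin; [exact: nearW|exact: qX].
  by rewrite (cvg_limn_einf_sup h).
have := @fatou _ _ _ P setT measurableT (fun n w => (q n w)%:E)
  (fun n => measurable_int _ (iq n)) (fun n w _ => q0 n w).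
under eq_integral do rewrite qE.
rewrite ge0_integralZl//; last 2 first.
- exact/measurable_EFinP.
- by move=> w _; rewrite lee_fin.
rewrite limn_einf_lim => /le_trans h.
have {h} : (2^-1%:E * \int[P]_w (X w ord0 j)%:E <= (C j)%:E)%E.
  apply: h; apply: lime_le; first exact: is_cvg_einfs.
  apply: nearW => n; apply: le_trans (qC n).
  by apply: ereal_inf_lbound; exists n => //=.
by rewrite lee_pdivrMl// => /le_lt_trans; apply; rewrite -EFinM ltry.
Qed.


Let is_derive_line j (t y : V) (h : R) :
  is_derive (h : R) (1 : R) (fun h => dot (t + h *: e j) y) (y ord0 j).
Proof.
under eq_fun do rewrite dotDl dotZl dot_delta.
apply: is_derive_eq (is_deriveD (is_derive_cst (dot t y) h (1 : R))
  (is_deriveM (is_derive_id h (1 : R)) (is_derive_cst (y ord0 j) h (1 : R)))) _.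
by rewrite /GRing.scale/= mulr0 !add0r mulr1.
Qed.

Let is_derive_cos_line j (t y : V) (h : R) : is_derive (h : R) (1 : R)
  (fun h => cos (dot (t + h *: e j) y)) (- (y ord0 j * sin (dot (t + h *: e j) y))).
Proof.
have hc := @is_derive1_comp R cos (fun h => dot (t + h *: e j) y) h _ _
  (is_derive_cos _) (is_derive_line j t y h).
by apply: is_derive_eq hc _; ring.
Qed.

Let is_derive_sin_line j (t y : V) (h : R) : is_derive (h : R) (1 : R)
  (fun h => sin (dot (t + h *: e j) y)) (y ord0 j * cos (dot (t + h *: e j) y)).
Proof.
have hc := @is_derive1_comp R sin (fun h => dot (t + h *: e j) y) h _ _
  (is_derive_sin _) (is_derive_line j t y h).
by apply: is_derive_eq hc _; ring.
Qed.

Let Xcos j t := \int[P]_w (X w ord0 j * cos (dot t (X w))).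
Let Xsin j t := \int[P]_w (X w ord0 j * sin (dot t (X w))).
Let Ycos j t := \int[Pi]_y (y ord0 j * cos (dot t y)).
Let Ysin j t := \int[Pi]_y (y ord0 j * sin (dot t y)).

Let integrable_cos_X t : P.-integrable setT (fun w => (cos (dot t (X w)))%:E).
Proof.
apply: (integrable_bounded (f := fun w => cos (dot t (X w))) (M := 1)) => [|w].
  exact: (measurableT_comp (measurable_cos_dot t)).
exact: cos_max.
Qed.

Let integrable_sin_X t : P.-integrable setT (fun w => (sin (dot t (X w)))%:E).
Proof.
apply: (integrable_bounded (f := fun w => sin (dot t (X w))) (M := 1)) => [|w].
  exact: (measurableT_comp (measurable_sin_dot t)).
exact: sin_max.
Qed.

Let integrable_Ycos j t : Pi.-integrable setT (fun y => (y ord0 j * cos (dot t y))%:E).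
Proof.
apply: (integrable_weighted (integrable_coord_levy j) (Z := id) _
  (h := fun y => cos (dot t y)) (M := 1)) => // [|y].
  exact: measurable_cos_dot.
exact: cos_max.
Qed.

Let integrable_Ysin j t : Pi.-integrable setT (fun y => (y ord0 j * sin (dot t y))%:E).
Proof.
apply: (integrable_weighted (integrable_coord_levy j) (Z := id) _
  (h := fun y => sin (dot t y)) (M := 1)) => // [|y].
  exact: measurable_sin_dot.
exact: sin_max.
Qed.

Let integrable_Xsin j t : P.-integrable setT (fun w => (X w ord0 j * sin (dot t (X w)))%:E).
Proof.
apply: (integrable_weighted (integrable_coord_X j) mX
  (h := fun y => sin (dot t y)) (M := 1)) => // [|y].
  exact: measurable_sin_dot.
exact: sin_max.
Qed.

Let is_derive_a j t : is_derive (0 : R) (1 : R) (fun h => a (t + h *: e j)) (- Ysin j t).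
Proof.
have df (h : R) y : is_derive (h : R) (1 : R) (fun h => cos (dot (t + h *: e j) y) - 1)
    (- (y ord0 j * sin (dot (t + h *: e j) y))).
  by apply: is_derive_eq (is_deriveB (is_derive_cos_line j t y h)
    (is_derive_cst (1 : R) h (1 : R))) _; rewrite subr0.
have ij := integrable_norm (integrable_coord_levy j).
have h := is_derive_integral (fun h => integrable_cos_dot (t + h *: e j) Pi1) df ij _ 0.
apply: is_derive_eq (h _) _ => [u y|].
  by rewrite normrN normrM ler_piMr// sin_max.
rewrite scale0r addr0 /Ysin -[RHS]mulN1r -RintegralZl//; last exact: integrable_Ysin.
by apply: eq_Rintegral => y _; rewrite mulN1r.
Qed.

Let is_derive_b j t : is_derive (0 : R) (1 : R) (fun h => b (t + h *: e j)) (Ycos j t).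
Proof.
have df (h : R) y := is_derive_sin_line j t y h.
have ij := integrable_norm (integrable_coord_levy j).
have h := is_derive_integral (fun h => integrable_sin_dot (t + h *: e j) Pi1) df ij _ 0.
apply: is_derive_eq (h _) _ => [u y|].
  by rewrite normrM ler_piMr// cos_max.
by rewrite scale0r addr0.
Qed.

Let is_derive_Ecos j t : is_derive (0 : R) (1 : R)
  (fun h => \int[P]_w cos (dot (t + h *: e j) (X w))) (- Xsin j t).
Proof.
have df (h : R) w := is_derive_cos_line j t (X w) h.
have ij := integrable_norm (integrable_coord_X j).
have h := is_derive_integral (fun h => integrable_cos_X (t + h *: e j)) df ij _ 0.
apply: is_derive_eq (h _) _ => [u y|].
  by rewrite normrN normrM ler_piMr// sin_max.
rewrite scale0r addr0 /Xsin -[RHS]mulN1r -RintegralZl//; last exact: integrable_Xsin.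
by apply: eq_Rintegral => y _; rewrite mulN1r.
Qed.

Let is_derive_Esin j t : is_derive (0 : R) (1 : R)
  (fun h => \int[P]_w sin (dot (t + h *: e j) (X w))) (Xcos j t).
Proof.
have df (h : R) w := is_derive_sin_line j t (X w) h.
have ij := integrable_norm (integrable_coord_X j).
have h := is_derive_integral (fun h => integrable_sin_X (t + h *: e j)) df ij _ 0.
apply: is_derive_eq (h _) _ => [u y|].
  by rewrite normrM ler_piMr// cos_max.
by rewrite scale0r addr0.
Qed.

(** Compares the two derivatives at 0 along t + h e_j: of the characteristic
    function under the expectation, and of exp(a) cos(b) and exp(a) sin(b). *)
Lemma chf_derivative j t :
  Xsin j t = (\int[P]_w cos (dot t (X w))) * Ysin j t + (\int[P]_w sin (dot t (X w))) * Ycos j t /\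
  Xcos j t = (\int[P]_w cos (dot t (X w))) * Ycos j t - (\int[P]_w sin (dot t (X w))) * Ysin j t.
Proof.
have da := is_derive_a j t; have db := is_derive_b j t.
have dexp := @is_derive1_comp R expR _ 0 _ _ (is_derive_expR _) da.
have dcos := @is_derive1_comp R cos _ 0 _ _ (is_derive_cos _) db.
have dsin := @is_derive1_comp R sin _ 0 _ _ (is_derive_sin _) db.
have [_ dc] := is_derive_Ecos j t; have [_ ds] := is_derive_Esin j t.
have [_ dc'] := is_deriveM dexp dcos; have [_ ds'] := is_deriveM dexp dsin.
have ec : (fun h => \int[P]_w cos (dot (t + h *: e j) (X w))) =
  (expR \o (fun h => a (t + h *: e j))) * (cos \o (fun h => b (t + h *: e j))).
  by apply/funext => h; rewrite chf_cos.
have es : (fun h => \int[P]_w sin (dot (t + h *: e j) (X w))) =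
  (expR \o (fun h => a (t + h *: e j))) * (sin \o (fun h => b (t + h *: e j))).
  by apply/funext => h; rewrite chf_sin.
rewrite !chf_cos !chf_sin; split.
- apply: oppr_inj; rewrite -dc ec dc' /= scale0r addr0 /GRing.scale/=; ring.
- rewrite -ds es ds' /= scale0r addr0 /GRing.scale/=; ring.
Qed.

Local Notation PPi := (P \x Pi)%E.
Let Z (p : Omega * V) := X p.1 + p.2.
Let k j (p : Omega * V) := p.2 ord0 j.

Let mZ : measurable_fun setT Z.
Proof.
by apply: measurable_addrV => //; exact: measurableT_comp.
Qed.

Let integrable_one : P.-integrable setT (EFin \o (fun _ : Omega => 1 : R)).
Proof. by apply: (integrable_bounded (M := 1)) => // w; rewrite normr1. Qed.

Let ik j : PPi.-integrable setT (EFin \o k j).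
Proof.
have := integrable_prod integrable_one (integrable_coord_levy j).
by under [X in _.-integrable _ X]eq_fun do rewrite mul1r.
Qed.

(** By [chf_derivative] and the addition formulas, both sides are functionals that
    agree on cos<t,.> and sin<t,.>. *)
Lemma stein_identity_bounded j (h : V -> R) M : measurable_fun setT h ->
  (forall y, `|h y| <= M) ->
  \int[P]_w (X w ord0 j * h (X w)) = \int[PPi]_p (p.2 ord0 j * h (X p.1 + p.2)).
Proof.
apply: (fourier_uniqueness (integrable_coord_X j) (ik j) mX mZ) => t.
- rewrite /weighted -/(Xcos j t) (chf_derivative j t).2.
  rewrite -(Rintegral_prod (integrable_cos_X t) (integrable_Ycos j t)).
  rewrite -(Rintegral_prod (integrable_sin_X t) (integrable_Ysin j t)) -RintegralB//; last 2 first.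
  + exact: (integrable_prod (integrable_cos_X t) (integrable_Ycos j t)).
  + exact: (integrable_prod (integrable_sin_X t) (integrable_Ysin j t)).
  by apply: eq_Rintegral => p _; rewrite /k /Z dotDr cosD; ring.
- rewrite /weighted -/(Xsin j t) (chf_derivative j t).1.
  rewrite -(Rintegral_prod (integrable_cos_X t) (integrable_Ysin j t)).
  rewrite -(Rintegral_prod (integrable_sin_X t) (integrable_Ycos j t)) -RintegralD//; last 2 first.
  + exact: (integrable_prod (integrable_cos_X t) (integrable_Ysin j t)).
  + exact: (integrable_prod (integrable_sin_X t) (integrable_Ycos j t)).
  by apply: eq_Rintegral => p _; rewrite /k /Z dotDr sinD; ring.
Qed.

(** The Stein identity for a nonnegative infinitely divisible vector without
    drift whose Levy measure has a first moment. *)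
Lemma stein_identity (g : V -> V) : measurable_fun setT g ->
  P.-integrable setT (fun w => (dot (X w) (g (X w)))%:E) ->
  PPi.-integrable setT (fun p => (dot p.2 (g (X p.1 + p.2)))%:E) ->
  \int[P]_w dot (X w) (g (X w)) = \int[PPi]_p dot p.2 (g (X p.1 + p.2)).
Proof.
move=> mg i1 i2.
have c1 := cvg_trunc mg mX mX integrable_coord_X i1.
have c2 := cvg_trunc mg measurable_snd mZ ik i2.
apply: (cvg_unique _ c1) => //.
rewrite (_ : (fun n => _) = (fun n => \sum_(j < d) \int[PPi]_p (p.2 ord0 j * trunc g n (Z p) ord0 j)))//.
apply/funext => n; apply: eq_bigr => j _.
apply: (stein_identity_bounded (h := fun y => trunc g n y ord0 j) j (M := n%:R)).
  by apply: measurable_coord_comp; exact: measurable_trunc.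
by move=> y; exact: trunc_coord_le.
Qed.

End stein_identity.

(** * The Stein operator *)

Section thorin.
Context {R : realType} {d : nat}.
Notation V := 'rV[R]_d.
Variable nu : {measure set V -> \bar R}.
Local Open Scope ereal_scope.

Lemma integral_orthantT (f : V -> \bar R) : nu (~` orthant) = 0 ->
  measurable_fun setT f -> (forall s, 0 <= f s) ->
  \int[nu]_s f s = \int[nu]_(s in orthant) f s.
Proof.
move=> nu_orthant mf f0.
have mO : measurable (~` @orthant R d) by apply: measurableC; exact: measurable_orthant.
by rewrite (ge0_negligible_integral mO)// setTD setCK.
Qed.

(** The extended logarithm is infinite at 0. *)
Lemma thorin_atom0 : thorin_measure nu -> nu [set 0%R] = 0.
Proof.
pose g (s : V) := `|lne (enorm s)%:E|.
have m0 : measurable [set (0 : V)%R] by exact: measurable_set0V.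
have mg : measurable_fun setT g.
  rewrite -(setvU [set (0 : V)%R]); apply/measurable_funU => //; first exact: measurableC.
  split; last exact: measurable_fun_set1.
  apply: (eq_measurable_fun (fun s => `|ln (enorm s)|%:E)).
    move=> s; rewrite inE/= => s0; rewrite /g lne_EFin// lt_def enorm_ge0 andbT.
    by apply/eqP => /enorm_eq0.
  apply: measurable_funTS; apply/measurable_EFinP; apply: measurableT_comp => //.
  by apply: (measurableT_comp (@measurable_ln R)); exact: measurable_enorm.
move=> [_ _ h _]; apply/eqP; apply: contraTT h => nu0.
rewrite -leNgt.
have -> : +oo = \int[nu]_(s in [set (0 : V)%R]) g s.
  rewrite (eq_integral (cst +oo)); last first.
    by move=> s; rewrite inE/= => ->; rewrite /g enorm0 le0_lneNy.
  by rewrite integral_cst// gt0_mulye// lt0e nu0 measure_ge0.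
apply: ge0_subset_integral => //.
- apply: measurableI; first exact: measurable_orthant.
  rewrite [X in measurable X](_ : _ = setT `&` @enorm R d @^-1` `]-oo, 1%R]); last first.
    by rewrite setTI; apply/seteqP; split => y /=; rewrite in_itv/=.
  by apply: measurable_enorm => //; exact: measurable_itv.
- exact: measurable_funTS.
- by move=> s _; exact: abse_ge0.
- by move=> s /= ->; rewrite enorm0 ler01; split => // i; rewrite mxE.
Qed.

End thorin.

(** Measurability holds even where the integral is undefined: there the difference
    of the two parts still takes a conventional value. *)
Lemma measurable_integral_param {d1 d2} {T1 : measurableType d1} {T2 : measurableType d2}
    {R : realType} (m : {sigma_finite_measure set T2 -> \bar R}) (f : T1 * T2 -> \bar R) :
  measurable_fun setT f -> measurable_fun setT (fun x => \int[m]_y f (x, y))%E.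
Proof.
move=> mf.
have -> : (fun x => \int[m]_y f (x, y))%E =
    (fun x => \int[m]_y f^\+ (x, y) - \int[m]_y f^\- (x, y))%E.
  apply/funext => x; rewrite integralE.
  by congr (_ - _)%E; apply: eq_integral => y _; rewrite ?funeposE ?funenegE.
apply: emeasurable_funB.
- by apply: measurable_fun_fubini_tonelli_F => //; exact: measurable_funepos.
- by apply: measurable_fun_fubini_tonelli_F => //; exact: measurable_funeneg.
Qed.

Section stein_operator.
Context {R : realType} {d : nat}.
Notation V := 'rV[R]_d.
Notation leb := (@lebesgue_measure R).
Notation gam := (@gamma_levy R).
Variable nu : {sigma_finite_measure set V -> \bar R}.
Hypothesis nu_orthant : nu (~` orthant) = 0%E.
Hypothesis nu0 : nu [set 0] = 0%E.
Hypothesis nu1 : (\int[nu]_s (enorm s)%:E < +oo)%E.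
Notation Pi := (levy_measure nu).

Lemma measurable_dot_shift (f : V -> V) (x : V) : measurable_fun setT f ->
  measurable_fun setT (fun y => dot y (f (x + y))).
Proof.
move=> mf; apply: measurable_dot => //; apply: (measurableT_comp mf).
exact: measurable_addrV.
Qed.

(** The cancellation behind the rewriting of the operator. *)
Lemma dot_ray (f : V -> V) (x s : V) (z : R) : 0 < z ->
  dot (z *: s) (f (x + z *: s)) * (expR (- z) / z) = expR (- z) * dot s (f (x + z *: s)).
Proof. by move=> z0; rewrite dotZl; field; rewrite gt_eqF. Qed.

Lemma stein_op_domP (f : V -> V) (x : V) : measurable_fun setT f ->
  stein_op_dom nu f x <-> Pi.-integrable setT (fun y => (dot y (f (x + y)))%:E).
Proof.
move=> mf; have md := measurable_dot_shift x mf.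
have mn : measurable_fun setT (fun y => `|(dot y (f (x + y)))%:E|%E).
  by apply: measurableT_comp => //; exact/measurable_EFinP.
have domE : (\int[nu]_(s in orthant) \int[leb]_(z in `]0%R, +oo[)
    (expR (- z) * `|dot s (f (x + z *: s))|)%:E = \int[Pi]_y `|(dot y (f (x + y)))%:E|)%E.
  rewrite -integral_levy_orthant// ge0_integral_levy_orthant//; last exact: measurable_funTS.
  apply: eq_integral => s _; apply: eq_integral => z; rewrite inE/= in_itv/= andbT => z0.
  by rewrite -EFinM; congr EFin; rewrite dotZl normrM gtr0_norm//; field; rewrite gt_eqF.
rewrite /stein_op_dom/= domE; split => [h|/integrableP[]//].
by apply/integrableP; split => //; exact/measurable_EFinP.
Qed.

Lemma integrable_levy_orthant (f : V -> R) : measurable_fun setT f ->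
  Pi.-integrable setT (EFin \o f) <-> Pi.-integrable orthant_neq0 (EFin \o f).
Proof.
move=> mf; split=> [|/integrableP[_ h]].
  by apply: integrableS => //; exact: measurable_orthant_neq0.
have mfE : measurable_fun setT (EFin \o f) by exact/measurable_EFinP.
apply/integrableP; split => //; rewrite -integral_levy_orthant//.
exact: measurableT_comp.
Qed.

Lemma stein_op_levyE (f : V -> V) (x : V) : measurable_fun setT f ->
  stein_op_dom nu f x -> stein_op nu f x = stein_op_levy Pi f x.
Proof.
move=> mf /(stein_op_domP x mf) fi.
rewrite /stein_op_levy Rintegral_levy//; last exact: measurable_dot_shift.
congr (_ - _); apply: eq_Rintegral => s _; apply: eq_Rintegral => z.
by rewrite inE/= in_itv/= andbT => z0; rewrite dot_ray.
Qed.

(** Written with the Levy measure, the operator contains a single integral, whose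
    linearity is immediate. *)
Lemma stein_op_linear (a : R) (f g : V -> V) (x : V) :
  measurable_fun setT f -> measurable_fun setT g ->
  stein_op_dom nu f x -> stein_op_dom nu g x ->
  stein_op_dom nu (fun y => a *: f y + g y) x /\
  stein_op nu (fun y => a *: f y + g y) x = a * stein_op nu f x + stein_op nu g x.
Proof.
move=> mf mg domf domg.
have mh : measurable_fun setT (fun y => a *: f y + g y).
  by apply: measurable_addrV => //; exact: measurable_scaleV.
have fi := (stein_op_domP x mf).1 domf; have gi := (stein_op_domP x mg).1 domg.
have hE y : dot y (a *: f (x + y) + g (x + y)) = a * dot y (f (x + y)) + dot y (g (x + y)).
  by rewrite dotDr dotZr.
have afi : Pi.-integrable setT (fun y => (a * dot y (f (x + y)))%:E).
  exact: (integrableZl measurableT a fi).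
have domh : stein_op_dom nu (fun y => a *: f y + g y) x.
  apply/(stein_op_domP x mh); under eq_fun do rewrite hE.
  exact: (integrableD measurableT afi gi).
split => //; rewrite !stein_op_levyE// /stein_op_levy.
have mO := @measurable_orthant_neq0 R d.
under eq_Rintegral do rewrite hE.
rewrite dotDr dotZr RintegralD// ?RintegralZl//; first by ring.
- exact: (integrableS measurableT mO _ fi).
- exact: (integrableS measurableT mO _ afi).
- exact: (integrableS measurableT mO _ gi).
Qed.

End stein_operator.

Section stein_expectation.
Context {R : realType} {d : nat} {disp : measure_display} {Omega : measurableType disp}.
Notation V := 'rV[R]_d.
Notation leb := (@lebesgue_measure R).
Notation gam := (@gamma_levy R).
Variables (P : probability Omega R) (X : {RV P >-> V}).
Variable nu : {sigma_finite_measure set V -> \bar R}.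
Hypothesis nu_orthant : nu (~` orthant) = 0%E.
Hypothesis nu0 : nu [set 0] = 0%E.
Hypothesis nu1 : (\int[nu]_s (enorm s)%:E < +oo)%E.
Hypothesis X0 : forall w, orthant (X w).
Hypothesis levyX : is_levy_measure P X (levy_measure nu).
Variable Pi : {sigma_finite_measure set V -> \bar R}.
Hypothesis PiE : levy_measure nu = Pi :> {measure set V -> \bar R}.

Let PiF : (Pi : set V -> \bar R) = levy_measure nu.
Proof. by have := congr1 (fun m : {measure set V -> \bar R} => m : set V -> \bar R) PiE. Qed.

Let Pi1 : (\int[Pi]_y (enorm y)%:E < +oo)%E.
Proof. by rewrite PiF levy_measure_moment. Qed.

Let mX : measurable_fun setT X. Proof. exact: measurable_funPT. Qed.

Lemma Rintegral_levy_orthantT (f : V -> R) : measurable_fun setT f ->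
  \int[levy_measure nu]_(y in orthant_neq0) f y = \int[Pi]_y f y.
Proof.
move=> mf; rewrite -PiE /Rintegral integral_levy_orthant//.
exact/measurable_EFinP.
Qed.

Let chf_parts t :
  \int[P]_w cos (dot t (X w)) =
    expR (\int[Pi]_y (cos (dot t y) - 1)) * cos (\int[Pi]_y sin (dot t y)) /\
  \int[P]_w sin (dot t (X w)) =
    expR (\int[Pi]_y (cos (dot t y) - 1)) * sin (\int[Pi]_y sin (dot t y)).
Proof.
have [_ _ [_ _ _ /(_ t)]] := levyX.
rewrite /chf /cintegral /cexp/=.
under eq_Rintegral do rewrite expR0 mul1r.
under [X in (_ +i* X)%C = _]eq_Rintegral do rewrite expR0 mul1r.
under [X in _ = (_ * cos _ +i* (expR X * _))%C]eq_Rintegral do rewrite expR0 mul1r.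
under [X in _ = (_ * cos X +i* _)%C]eq_Rintegral do rewrite expR0 mul1r oppr0 addr0.
under [X in _ = (_ +i* (_ * sin X))%C]eq_Rintegral do rewrite expR0 mul1r oppr0 addr0.
under [X in _ = (expR X * _ +i* _)%C]eq_Rintegral do rewrite expR0 mul1r.
rewrite !Rintegral_levy_orthantT//; last 2 first.
- exact: measurable_sin_dot.
- by apply: measurable_funB => //; exact: measurable_cos_dot.
by move=> [-> ->].
Qed.

Section test_function.
Variable f : V -> V.
Hypothesis mf : measurable_fun setT f.
Hypothesis iXf : P.-integrable setT (fun w => (dot (X w) (f (X w)))%:E).
Hypothesis isf : (\int[nu]_(s in orthant) \int[leb]_(z in `]0%R, +oo[)
  ((expR (- z))%:E * \int[P]_w (`|dot s (f (X w + z *: s))|%R)%:E) < +oo)%E.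

Let G (p : Omega * V) := dot p.2 (f (X p.1 + p.2)).

Let mG : measurable_fun setT G.
Proof.
apply: measurable_dot => //; apply: (measurableT_comp mf).
by apply: measurable_addrV => //; exact: measurableT_comp.
Qed.

(** Tonelli's theorem and the formula for integrals against the Levy measure
    turn the iterated integral of the hypothesis into the integral of |G|. *)
Let iG : (P \x Pi)%E.-integrable setT (EFin \o G).
Proof.
apply/integrable21ltyP; first exact/measurable_EFinP.
have mabsG : measurable_fun setT (fun p : Omega * V => `|(EFin \o G) p|%E).
  by apply: measurableT_comp => //; exact/measurable_EFinP.
have mg : measurable_fun setT (fun y => \int[P]_w `|(EFin \o G) (w, y)|)%E.
  by apply: (measurable_fun_fubini_tonelli_G _ mabsG).
apply: le_lt_trans isf; rewrite PiF -integral_levy_orthant//.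
rewrite ge0_integral_levy_orthant//; last 2 first.
- exact: measurable_funTS.
- by move=> y _; exact: integral_ge0.
rewrite le_eqVlt; apply/orP; left; apply/eqP.
apply: eq_integral => s _; apply: eq_integral => z; rewrite inE/= in_itv/= andbT => z0.
have ms : measurable_fun setT (fun w => (`|dot s (f (X w + z *: s))|%R)%:E).
  apply/measurable_EFinP; apply: measurableT_comp => //; apply: measurable_dot => //.
  by apply: (measurableT_comp mf); exact: measurable_addrV.
under eq_integral do rewrite /= /G/= dotZl normrM (gtr0_norm z0) EFinM.
rewrite ge0_integralZl//; last by rewrite lee_fin ltW.
rewrite muleAC; congr (_ * _)%E.
rewrite -EFinM; congr EFin.
by field; rewrite gt_eqF.
Qed.

Lemma ae_stein_op_dom : {ae P, forall w, stein_op_dom nu f (X w)}.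
Proof.
have := ae_integrable1 iG; apply: filterS => w iw.
by apply/(stein_op_domP nu_orthant nu0 (X w) mf); rewrite -PiF.
Qed.

Lemma ae_stein_opE : {ae P, forall w, (stein_op nu f (X w))%:E =
  (dot (X w) (f (X w)))%:E - fubini_F Pi (EFin \o G) w}%E.
Proof.
have := ae_integrable1 iG; apply: filterS => w iw.
have domw : stein_op_dom nu f (X w).
  by apply/(stein_op_domP nu_orthant nu0 (X w) mf); rewrite -PiF.
rewrite (stein_op_levyE nu_orthant nu0 mf domw) /stein_op_levy.
rewrite Rintegral_levy_orthantT; last exact: measurable_dot_shift.
rewrite EFinB /Rintegral fineK//.
exact: integrable_fin_num iw.
Qed.

(** Equality almost everywhere with a measurable function does not suffice, as P is not
    assumed complete; so the conventional values off the domain must be handled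
    too, through the measurability of parametrized integrals. *)
Lemma measurable_stein_op : measurable_fun setT (fun w => stein_op nu f (X w)).
Proof.
have mH : measurable_fun setT (fun p : (Omega * V) * R =>
    (dot (p.2 *: p.1.2) (f (X p.1.1 + p.2 *: p.1.2)))%:E).
  have m11 : measurable_fun setT (fun p : (Omega * V) * R => p.1.1).
    by apply: (measurableT_comp measurable_fst); exact: measurable_fst.
  have m12 : measurable_fun setT (fun p : (Omega * V) * R => p.1.2).
    by apply: (measurableT_comp measurable_snd); exact: measurable_fst.
  have mzs : measurable_fun setT (fun p : (Omega * V) * R => p.2 *: p.1.2).
    exact: measurable_scaleV.
  apply/measurable_EFinP; apply: measurable_dot => //.
  apply: (measurableT_comp mf); apply: measurable_addrV => //.
  exact: (measurableT_comp mX).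
have mH1 := measurable_integral_param gam mH.
have mO := @measurable_orthant R d.
have mH2 : measurable_fun setT (fun p : Omega * V =>
    ((fine (\int[gam]_z (dot (z *: p.2) (f (X p.1 + z *: p.2)))%:E)) * \1_orthant p.2)%:E)%E.
  apply/measurable_EFinP; apply: measurable_funM.
    by apply: measurableT_comp mH1; exact: fine_measurable.
  by apply: measurableT_comp => //; exact: measurable_indic.
have mH3 := measurable_integral_param nu mH2.
rewrite (_ : (fun w => stein_op nu f (X w)) = (fun w => dot (X w) (f (X w)) -
    fine (\int[nu]_s ((fine (\int[gam]_z (dot (z *: s) (f (X w + z *: s)))%:E)) * \1_orthant s)%:E)%E)).
  apply: measurable_funB.
    by apply: measurable_dot => //; exact: measurableT_comp.
  by apply: (measurableT_comp _ mH3); exact: fine_measurable.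
apply/funext => w; congr (_ - _).
rewrite Rintegral_mkcond /Rintegral; congr fine; apply: eq_integral => s _; congr EFin.
rewrite patchE indicE; case: ifPn => _; last by rewrite mulr0.
rewrite mulr1 integral_gamma_levyE; last first.
  have mzs : measurable_fun setT (fun z : R => z *: s) by exact: measurable_scaleV.
  apply: measurable_dot => //; apply: (measurableT_comp mf).
  exact: measurable_addrV.
congr fine; apply: eq_integral => z; rewrite inE/= in_itv/= andbT => z0.
by rewrite dot_ray.
Qed.

Lemma integrable_stein_op : P.-integrable setT (fun w => (stein_op nu f (X w))%:E).
Proof.
have ms : measurable_fun setT (fun w => (stein_op nu f (X w))%:E).
  by apply/measurable_EFinP; exact: measurable_stein_op.
have /integrableP[mB iB] : P.-integrable setT
    (fun w => (dot (X w) (f (X w)))%:E - fubini_F Pi (EFin \o G) w)%E.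
  by apply: integrableB => //; exact: integrable_fubini_F.
apply/integrableP; split => //.
rewrite (ae_eq_integral (fun w => `|(dot (X w) (f (X w)))%:E - fubini_F Pi (EFin \o G) w|%E))//.
- exact: measurableT_comp.
- exact: measurableT_comp.
- by apply: filterS ae_stein_opE => w h _; rewrite h.
Qed.

Lemma expectation_stein_op : ('E_P[fun w => stein_op nu f (X w)] = 0)%E.
Proof.
rewrite unlock.
have iF := integrable_fubini_F iG.
rewrite (ae_eq_integral (fun w => (dot (X w) (f (X w)))%:E - fubini_F Pi (EFin \o G) w)%E)//.
- rewrite integralB// integral12_prod_meas1//.
  have := stein_identity X0 Pi1 (fun t => (chf_parts t).1) (fun t => (chf_parts t).2) mf iXf iG.
  rewrite /Rintegral => h.
  have /fineK <- := integrable_fin_num measurableT iXf.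
  have /fineK <- := integrable_fin_num measurableT iG.
  by rewrite h -EFinB subrr.
- by apply/measurable_EFinP; exact: measurable_stein_op.
- apply: emeasurable_funB; first exact: measurable_int iXf.
  exact: measurable_int iF.
- by apply: filterS ae_stein_opE => w h _.
Qed.

End test_function.
End stein_expectation.

(** * The two forms of the Stein operator *)

Theorem theorem4p5 (R : realType) (d : nat) (hd : (0 < d)%N)
    (nu : {measure set 'rV[R]_d -> \bar R}) (hnu : thorin_measure nu)
    (hnu1 : (\int[nu]_(s in orthant) (enorm s)%:E < +oo)%E)
    (disp : measure_display) (Omega : measurableType disp)
    (P : probability Omega R) (X : {RV P >-> 'rV[R]_d}) (hX : is_ggc P X nu)
    (F : set ('rV[R]_d -> 'rV[R]_d))
    (hF : forall f, F f -> stein_identity_defined P X nu f) :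
  [/\ is_stein_operator P X F (stein_op_dom nu) (stein_op nu),
      is_levy_measure P X (levy_measure nu),
      forall g : 'rV[R]_d -> R,
        measurable_fun orthant_neq0 g ->
        (forall y, orthant_neq0 y -> 0 <= g y) ->
        (\int[levy_measure nu]_(y in orthant_neq0) (g y)%:E =
         \int[nu]_(s in orthant) \int[lebesgue_measure]_(z in `]0%R, +oo[)
           (g (z *: s) * (expR (- z) / z))%:E)%E &
      forall f, F f -> forall x : 'rV[R]_d,
        (stein_op_dom nu f x <->
         (levy_measure nu).-integrable orthant_neq0
           (fun y => (dot y (f (x + y)))%:E)) /\
        (stein_op_dom nu f x ->
         stein_op nu f x = stein_op_levy (levy_measure nu) f x)].
Proof.
have nu_orthant : nu (~` orthant) = 0%E by case: hnu.
have nu0 := thorin_atom0 hnu.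
have nu1 : (\int[nu]_s (enorm s)%:E < +oo)%E.
  rewrite integral_orthantT//; first by apply/measurable_EFinP; exact: measurable_enorm.
  by move=> s; rewrite lee_fin enorm_ge0.
have [nu' nuE] := ex_sigma_finite (sigma_finite_enorm nu0 nu1).
subst nu.
case: hX => _ X0 logX.
have levyX : is_levy_measure P X (levy_measure nu') by exact: ggc_levy_measure.
have Pi0 : levy_measure nu' [set 0] = 0%E.
  apply/eqP; rewrite -measure_le0 -[leRHS](levy_measure_orthant nu_orthant nu0).
  apply: le_measure; rewrite ?inE.
  - exact: measurable_set0V.
  - by apply: measurableC; exact: measurable_orthant_neq0.
  - by move=> y /= -> [_]; apply.
have Pi1 : (\int[levy_measure nu']_y (enorm y)%:E < +oo)%E by rewrite levy_measure_moment.
have [Pi PiE] := ex_sigma_finite (sigma_finite_enorm Pi0 Pi1).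
have mF f : F f -> measurable_fun setT f by move=> /hF[].
split.
- split=> [a f g h Ff Fg _ x domf domg|f Ff].
    exact: (stein_op_linear nu_orthant nu0 a (mF _ Ff) (mF _ Fg) domf domg).
  have [mf iXf isf] := hF _ Ff; split.
  + exact: (ae_stein_op_dom nu_orthant nu0 PiE mf isf).
  + exact: (integrable_stein_op nu_orthant nu0 PiE mf iXf isf).
  + exact: (expectation_stein_op nu_orthant nu0 nu1 X0 levyX PiE mf iXf isf).
- exact: levyX.
- move=> g mg g0; rewrite ge0_integral_levy_orthant//; exact/measurable_EFinP.
- move=> f Ff x; have mf := mF _ Ff; split; last exact: stein_op_levyE.
  apply: (iff_trans (stein_op_domP nu_orthant nu0 x mf)).
  exact: (integrable_levy_orthant nu_orthant nu0 (measurable_dot_shift x mf)).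
Qed.
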